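(* Let $\beta>0$ and let $h\in\mathcal{G}_0$ be a $\mathcal{C}^2$-isomorphism of $[0,1]$. Then the translation $\tau_h:\mathcal{G}_0\to\mathcal{G}_0$, $g\mapsto h\circ g$, leaves $\mathbb{Q}_0^\beta$ quasi-invariant: $$\frac{d(\tau_{h^{-1}})_*\mathbb{Q}_0^\beta}{d\mathbb{Q}_0^\beta}(g)=Y^\beta_{h,0}(g).$$ The function $Y^\beta_{h,0}$ is bounded from above and from below away from $0$ on $\mathcal{G}_0$.
   Context: $\mathcal{G}_0$ is the set of right continuous nondecreasing maps $g:[0,1[\,\to[0,1]$, each extended by $g(1):=1$. $\mathbb{Q}_0^\beta$ is the probability measure on $\mathcal{G}_0$ such that for every $N$ and $0=t_0<t_1<\dots<t_N<t_{N+1}=1$ the law of $(g(t_1),\dots,g(t_N))$ is $\frac{\Gamma(\beta)}{\prod_{i=0}^{N}\Gamma(\beta(t_{i+1}-t_i))}\prod_{i=0}^{N}(x_{i+1}-x_i)^{\beta(t_{i+1}-t_i)-1}dx_1\cdots dx_N$ on $\{0<x_1<\dots<x_N<1\}$, $x_0:=0,x_{N+1}:=1$. A $\mathcal{C}^2$-isomorphism $h\in\mathcal{G}_0$ is an increasing homeomorphism $h:[0,1]\to[0,1]$ such that $h$ and $h^{-1}$ are bounded in $\mathcal{C}^2([0,1])$ (so $h'>0$). For such $h$ and $g\in\mathcal{G}_0$, let $J_g\subset\,]0,1[$ be the set of jump locations of $g$, $\frac{\delta(h\circ g)}{\delta g}(a):=\frac{h(g(a+))-h(g(a-))}{g(a+)-g(a-)}$,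 $$Y_h^0(g):=\prod_{a\in J_g}\frac{\sqrt{h'(g(a-))h'(g(a+))}}{\frac{\delta(h\circ g)}{\delta g}(a)},\quad X_h^\beta(g):=\exp\Big(\beta\int_0^1\log h'(g(s))ds\Big),\quad Y^\beta_{h,0}(g):=X_h^\beta(g)\cdot\frac{1}{\sqrt{h'(0)h'(1)}}\cdot Y_h^0(g).$$ *)

(* Defs.v *)
From HB Require Import structures.
From mathcomp Require Import all_boot all_order all_algebra.
From mathcomp Require Import all_classical all_reals all_analysis.
Set Implicit Arguments. Unset Strict Implicit. Unset Printing Implicit Defensive.
Import Order.TTheory GRing.Theory Num.Theory.
Import numFieldNormedType.Exports.
Local Open Scope classical_set_scope.
Local Open Scope ring_scope.

Section G0.
Variable R : realType.

(* g in G_0: right continuous nondecreasing g : [0,1[ -> [0,1], with g(1) := 1.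
   Normalised representative as a function R -> R: g = 0 on ]-oo,0[ and
   g = 1 on [1,+oo[ (these values carry no information). *)
Definition isG0 (g : R -> R) : Prop :=
  [/\ {in `[0, 1[ &, {homo g : s t / s <= t}},
      (forall t, 0 <= t < 1 -> 0 <= g t <= 1),
      (forall t, 0 <= t < 1 -> g x @[x --> t^'+] --> g t),
      (forall t, t < 0 -> g t = 0) &
      (forall t, 1 <= t -> g t = 1)].

Definition step01 (t : R) : R := if t < 0 then 0 else 1.

Lemma step01_G0 : isG0 step01.
Proof.
rewrite /step01; split.
- move=> s t; rewrite !in_itv /= => /andP[s0 _] /andP[t0 _] _.
  by rewrite !ltNge s0 t0.
- by move=> t /andP[t0 _]; rewrite ltNge t0 /= ler01 lexx.
- move=> t /andP[t0 _]; rewrite ltNge t0 /=.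
  apply: cvg_near_cst; near=> x.
  have tx : t < x by near: x; exact: nbhs_right_gt.
  by rewrite ltNge (le_trans t0 (ltW tx)).
- by move=> t ->.
- by move=> t t1; rewrite ltNge (le_trans _ t1) // ler01.
Unshelve. all: by end_near.
Qed.

Definition G0 := {g : R -> R | isG0 g}.
HB.instance Definition _ := gen_eqMixin G0.
HB.instance Definition _ := gen_choiceMixin G0.
HB.instance Definition _ := isPointed.Build G0 (exist _ step01 step01_G0).

Definition G0_cylinders : set (set G0) :=
  [set A | exists t (B : set R), measurable B /\ A = [set g | B (sval g t)]].

Local Notation G0m := (g_sigma_algebraType G0_cylinders).


Local Open Scope ereal_scope.

Definition Gamma (s : R) : R :=
  fine (\int[@lebesgue_measure R]_(x in `]0%R, +oo[%classic)
          ((x `^ (s - 1)) * expR (- x))%:E).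

Fixpoint iint (k : nat) (F : (nat -> R) -> \bar R) (x : nat -> R) : \bar R :=
  match k with
  | O => F x
  | S k' => \int[@lebesgue_measure R]_(y in [set: R])
              iint k' F (fun i => if i == k then y else x i)
  end.

Local Close Scope ereal_scope.

(* Dirichlet density of (g(t_1),...,g(t_N)) under Q_0^beta, with
   t_0 = 0, t_{N+1} = 1, x_0 := 0, x_{N+1} := 1; it vanishes outside
   the simplex {0 < x_1 < ... < x_N < 1}. *)
Definition dir_density (beta : R) (N : nat) (t x : nat -> R) : R :=
  let xx i := if i == 0%N then 0 else if i == N.+1 then 1 else x i in
  if `[< forall i, (i <= N)%N -> xx i < xx i.+1 >] then
    Gamma beta / (\prod_(i < N.+1) Gamma (beta * (t i.+1 - t i))) *
    \prod_(i < N.+1) (xx i.+1 - xx i) `^ (beta * (t i.+1 - t i) - 1)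
  else 0.

(* Q has the finite dimensional marginals of Q_0^beta: for every N >= 1 and
   0 = t_0 < t_1 < ... < t_N < t_{N+1} = 1, the law of (g(t_1),...,g(t_N))
   has density dir_density (stated through its distribution function). *)
Definition dirichlet_marginals (beta : R) (Q : probability (G0m) R) : Prop :=
  forall (N : nat) (t : nat -> R), (0 < N)%N -> t 0%N = 0 -> t N.+1 = 1 ->
  (forall i, (i <= N)%N -> t i < t i.+1) ->
  forall y : nat -> R,
    Q [set g : G0m | forall i, (1 <= i <= N)%N -> sval g (t i) <= y i] =
    iint N (fun x => (dir_density beta N t x *
        (if `[< forall i, (1 <= i <= N)%N -> x i <= y i >] then 1 else 0))%:E)
      (fun _ => 0).

(* f : R -> R is C^2 (on a neighbourhood of [0,1]; here on R) *)
Definition isC2 (f : R -> R) : Prop :=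
  [/\ (forall x, derivable f x 1), (forall x, derivable (derive1 f) x 1) &
      continuous (derive1 (derive1 f))].

Definition C2_isomorphism (h : R -> R) : Prop :=
  [/\ isC2 h, h 0 = 0, h 1 = 1, {in `[0, 1] &, {homo h : x y / x < y}} &
      exists hinv : R -> R, [/\ isC2 hinv,
        (forall y, 0 <= y <= 1 -> 0 <= hinv y <= 1 /\ h (hinv y) = y) &
        (forall x, 0 <= x <= 1 -> 0 <= h x <= 1 /\ hinv (h x) = x)]].

Definition lft (g : R -> R) (a : R) : R := lim (g x @[x --> a^'-]).
Definition rgt (g : R -> R) (a : R) : R := lim (g x @[x --> a^'+]).

Definition jumps (g : R -> R) : set R :=
  [set a | 0 < a < 1 /\ lft g a != rgt g a].

Definition jumps_ge (g : R -> R) (e : R) : set R :=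
  [set a | jumps g a /\ e <= rgt g a - lft g a].

Definition jfactor (h g : R -> R) (a : R) : R :=
  Num.sqrt (derive1 h (lft g a) * derive1 h (rgt g a)) /
  ((h (rgt g a) - h (lft g a)) / (rgt g a - lft g a)).

(* Y_h^0(g) = prod_{a in J_g} jfactor: the (absolutely convergent) countable
   product, as the limit of the finite products over the jumps of size
   >= 1/(n+1) *)
Definition Y0 (h g : R -> R) : R :=
  limn (fun n : nat => \big[*%R/1]_(a \in jumps_ge g (n.+1%:R)^-1) jfactor h g a).

Definition Xb (beta : R) (h g : R -> R) : R :=
  expR (beta * Rintegral (@lebesgue_measure R) `[0, 1]%classic
                 (fun s => ln (derive1 h (g s)))).

Definition Yb0 (beta : R) (h g : R -> R) : R :=
  Xb beta h g * (Num.sqrt (derive1 h 0 * derive1 h 1))^-1 * Y0 h g.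

(* tau_h(A) = (tau_{h^{-1}})^{-1}(A) = {g | h^{-1} o g in A} *)
Definition tau_img (h : R -> R) (A : set G0m) : set G0m :=
  [set g | exists2 g', A g' & sval g = h \o sval g'].

End G0.

Notation G0m R := (g_sigma_algebraType (@G0_cylinders R)).

(* Main.v *)
(** On a grid 0 = t_0 < ... < t_{N+1} = 1 the change of variables x |-> h(x) turns
    the Dirichlet density into itself times
      prod h'(x_i) * prod (Dh_i / Dx_i)^(beta Dt_i - 1),
    where Dh_i / Dx_i is the slope of h on [x_i, x_{i+1}].  Taking logarithms, this
    is a Riemann sum for beta * int log h'(g), minus (log h'(0) + log h'(1)) / 2, plus
    the sum of j(x_i, x_{i+1}), where
      j(x, y) = (log h'(x) + log h'(y)) / 2 - log ((h y - h x) / (y - x))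
    is both O(y - x) and o(y - x).  Along dyadic grids, x_i = g(t_i), the continuous
    part of g therefore contributes nothing to the last sum, which converges to the
    sum of j over the jumps of g.  All bounds are uniform in g, so dominated
    convergence identifies the density on every dyadic cylinder, and dyadic cylinders
    generate the sigma-algebra. *)

Require Import Defs.
From mathcomp Require Import all_boot all_order all_algebra.
From mathcomp Require Import finmap.
From mathcomp Require Import all_classical all_reals all_analysis.
From mathcomp Require Import measurable_realfun.
From mathcomp Require Import ring lra.
Set Implicit Arguments. Unset Strict Implicit. Unset Printing Implicit Defensive.
Import Order.TTheory GRing.Theory Num.Theory.
Import numFieldNormedType.Exports.
Local Open Scope classical_set_scope.
Local Open Scope ring_scope.

(** * Positive linear functionals with monotone convergence *)

Section integral_functionals.
Local Open Scope ereal_scope.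
Context {R : realType}.

(** The overview hides a mismatch at the boundary. The Dirichlet density is written with the end
    values 0 and 1, while convergence along a path produces the end values g(0) and g(1-), since
    jumps at the ends are not in J_g. The two agree only for almost every g, and this must be
    extracted from the marginals. It comes from the finite-dimensional identity itself, applied with
    integrand 1 to one explicit map and one grid point s, with s tending to 0 and to 1. That map has
    a pole outside [0,1], which is why the finite-dimensional part asks only for a diffeomorphism of
    [0,1]. Convergence and bounds of the densities are proved for every g, as boundedness on all of
    G0 demands.

    The o(y - x) bound on j rests on continuity of h'': the trapezoid error is a difference of two
    values of h''. Iterated, weighted and transported integrals are all treated as functionals on
    nonnegative functions, so that one uniqueness principle on pi-systems serves the change of
    variables, the marginal laws and the final identity. *)

Definition nnm d (T : measurableType d) (f : T -> \bar R) :=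
  measurable_fun [set: T] f /\ forall x, 0 <= f x.

(** An axiomatic integral: [iint] is not given as integration against a measure, yet it has these
    properties, and they survive adding a density, a pushforward and integration over a
    parameter. *)
Definition integral_like d (T : measurableType d)
    (I : (T -> \bar R) -> \bar R) : Prop :=
  [/\ forall f, nnm f -> 0 <= I f,
      forall f g, nnm f -> nnm g -> (forall x, f x <= g x) -> I f <= I g,
      forall f g, nnm f -> nnm g -> I (f \+ g) = I f + I g,
      forall (r : R) f, (0 <= r)%R -> nnm f ->
        I (fun x => r%:E * f x) = r%:E * I f &
      forall f_ : nat -> T -> \bar R, (forall n, nnm (f_ n)) ->
        (forall x, nondecreasing_seq (f_ ^~ x)) ->
        I (fun x => limn (f_ ^~ x)) = limn (fun n => I (f_ n))].

Section theory.
Context d (T : measurableType d).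
Implicit Types (I J : (T -> \bar R) -> \bar R) (f g : T -> \bar R).

Lemma nnmM f g : nnm f -> nnm g -> nnm (fun x => f x * g x).
Proof.
move=> [mf f0] [mg g0]; split; first exact: emeasurable_funM.
by move=> x; rewrite mule_ge0.
Qed.

Lemma nnm_cst (r : \bar R) : 0 <= r -> nnm (fun _ : T => r).
Proof. by move=> r0; split. Qed.

Lemma nnmZ (r : R) f : (0 <= r)%R -> nnm f -> nnm (fun x => r%:E * f x).
Proof. by move=> r0; apply/nnmM/nnm_cst; rewrite lee_fin. Qed.

Lemma nnm_indic (A : set T) : measurable A -> nnm (EFin \o \1_A : T -> \bar R).
Proof.
move=> mA; split; first exact/measurable_EFinP/measurable_indic.
by move=> x /=; rewrite lee_fin.
Qed.

Lemma nnm_sum n (F : 'I_n -> T -> \bar R) : (forall i, nnm (F i)) ->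
  nnm (fun x => \sum_(i < n) F i x).
Proof.
move=> nF; split=> [|x]; first by apply: emeasurable_sum => i; case: (nF i).
by apply: sume_ge0 => i _; case: (nF i).
Qed.

Lemma nnm_comp d' (T' : measurableType d') (m : T' -> T) f :
  measurable_fun setT m -> nnm f -> nnm (f \o m).
Proof.
by move=> mm [mf f0]; split; [exact: measurableT_comp|move=> x /=].
Qed.

Lemma integral_like_sum I n (c : 'I_n -> R) (F : 'I_n -> T -> \bar R) :
  integral_like I -> (forall i, (0 <= c i)%R) -> (forall i, nnm (F i)) ->
  I (fun x => \sum_(i < n) (c i)%:E * F i x) =
  \sum_(i < n) (c i)%:E * I (F i).
Proof.
move=> [_ _ ID IZ _] c0 nF; elim: n => [|n IH] in c F c0 nF *.
  under eq_fun do rewrite big_ord0.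
  rewrite big_ord0 -[LHS]/(I (fun _ => 0)).
  have <- : (fun x : T => 0%:E * (fun _ : T => 0%R%:E) x) = (fun _ => 0)
      :> (T -> \bar R).
    by apply/funext => x; rewrite mul0e.
  by rewrite IZ// ?mul0e//; exact: nnm_cst.
under eq_fun do rewrite big_ord_recr/=.
rewrite big_ord_recr/= -IZ// -IH// -ID//.
  by apply: nnm_sum => i; exact: nnmZ.
exact: nnmZ.
Qed.

Import HBNNSimple.

Lemma integral_like_eq_indic I J : integral_like I -> integral_like J ->
  (forall A, measurable A -> I (EFin \o \1_A) = J (EFin \o \1_A)) ->
  forall f, nnm f -> I f = J f.
Proof.
move=> HI HJ IJ f [mf f0].
pose f_ := nnsfun_approx measurableT mf.
pose g_ n x := (f_ n x)%:E.
have nng n : nnm (g_ n).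
  by split=> [|x]; [exact/measurable_EFinP|rewrite lee_fin].
have ndg x : nondecreasing_seq (g_ ^~ x).
  by move=> a b ab; rewrite lee_fin; exact/lefP/nd_nnsfun_approx.
have -> : f = (fun x => limn (g_ ^~ x)).
  apply/funext => x; apply/esym/cvg_lim => //.
  by have /(_ x Logic.I) := cvg_nnsfun_approx measurableT mf (fun x _ => f0 x).
have [_ _ _ _ ->//] := HI; have [_ _ _ _ ->//] := HJ.
congr (limn _); apply/funext => n.
have fr : finite_set (range (f_ n)) by [].
pose s := fset_set (range (f_ n)).
pose m := size s.
have gE : g_ n = fun x => \sum_(i < m) ((s`_i)%R)%:E *
    (EFin \o \1_(f_ n @^-1` [set (s`_i)%R])) x.
  apply/funext => x; rewrite /g_ fimfunE -fsumEFin//= fsbig_finite//= -/s.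
  rewrite (big_nth 0%R) big_mkord; apply: eq_bigr => i _.
  by rewrite EFinM.
have s0 (i : 'I_m) : (0 <= s`_i)%R.
  have : s`_i \in s by apply: mem_nth.
  by rewrite in_fset_set// inE => -[x _ <-].
have mi (i : 'I_m) : measurable (f_ n @^-1` [set (s`_i)%R]) by [].
by rewrite gE !integral_like_sum//; [apply: eq_bigr => i _; rewrite IJ|
   move=> i; exact: nnm_indic..].
Qed.

(** Dynkin's argument: the measurable sets on whose indicators [I] and [J] agree form a
    lambda-system. Finite mass permits the subtraction for proper differences. *)
Lemma integral_like_uniq (G : set (set T)) I J :
  @measurable _ T = <<s G >> -> setI_closed G ->
  integral_like I -> integral_like J -> I (cst 1) \is a fin_num ->
  I (cst 1) = J (cst 1) ->
  (forall A, G A -> I (EFin \o \1_A) = J (EFin \o \1_A)) ->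
  forall f, nnm f -> I f = J f.
Proof.
move=> mG GI HI HJ I1 IJ1 IJ; apply: integral_like_eq_indic => // A mA.
have {}IJ1 : I (EFin \o \1_setT) = J (EFin \o \1_setT).
  by rewrite indicT.
have {}I1 : I (EFin \o \1_setT) \is a fin_num by rewrite indicT.
pose H := [set A | measurable A /\ I (EFin \o \1_A) = J (EFin \o \1_A)].
suff : H A by case.
have Ifin (K : (T -> \bar R) -> \bar R) (B : set T) : integral_like K ->
    K (EFin \o \1_setT) \is a fin_num -> measurable B ->
    K (EFin \o \1_B) \is a fin_num.
  move=> HK K1 mB; have [K0 Kle _ _ _] := HK.
  rewrite ge0_fin_numE; last exact/K0/nnm_indic.
  apply: le_lt_trans (_ : K (EFin \o \1_setT) < +oo); last by rewrite ltey_eq K1.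
  apply: Kle => //; [exact: nnm_indic..|].
  by move=> x /=; rewrite lee_fin !indicE in_setT; case: (_ \in _).
have lH : lambda_system setT H.
  split => //.
  - move=> B C CB [mB HB] [mC HC]; split; first exact: measurableD.
    have BE : EFin \o \1_B = (EFin \o \1_C) \+ (EFin \o \1_(B `\` C)) :> (T -> \bar R).
      apply/funext => x /=; rewrite -EFinD; congr EFin.
      rewrite !indicE in_setD.
      have [xC|] := boolP (x \in C); last by rewrite add0r andbT.
      by rewrite andbF addr0; move: xC; rewrite inE => /CB xB; rewrite mem_set.
    have mBC := measurableD mB mC.
    have [[_ _ ID _ _] [_ _ JD _ _]] := (HI, HJ).
    move: HB; rewrite BE (ID _ _ (nnm_indic mC) (nnm_indic mBC)).
    rewrite (JD _ _ (nnm_indic mC) (nnm_indic mBC)).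
    rewrite HC => JBC.
    have JC : J (EFin \o \1_C) \is a fin_num by rewrite -HC; exact: Ifin.
    rewrite -[LHS](@addeK _ _ _ JC) -[RHS](@addeK _ _ _ JC); congr (_ - _).
    by rewrite addeC JBC addeC.
  - move=> F ndF HF; split; first by apply: bigcupT_measurable => n; case: (HF n).
    have FE : EFin \o \1_(\bigcup_n F n) =
        (fun x => limn (fun n => (EFin \o \1_(F n)) x)) :> (T -> \bar R).
      apply/funext => x; apply/esym/cvg_lim => //.
      have [[n _ Fnx]|nF] := pselect ((\bigcup_n F n) x).
        apply: cvg_near_cst; near=> m.
        have Fmx : F m x.
          have /ndF/subsetPset : (n <= m)%N by near: m; exact: nbhs_infty_ge.
          exact.
        by rewrite /= !indicE (mem_set Fmx) mem_set//; exists n.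
      apply: cvg_near_cst; apply: nearW => m.
      have nFm : ~ F m x by apply: contra_not nF => Fmx; exists m.
      by rewrite /= !indicE (memNset nFm) memNset.
    have ndi x : nondecreasing_seq (fun n => (EFin \o \1_(F n)) x : \bar R).
      move=> a b ab /=; rewrite lee_fin !indicE ler_nat.
      have [xa|//] := boolP (x \in F a).
      have /subsetPset Fab := ndF _ _ ab.
      by rewrite mem_set//; apply: Fab; exact: set_mem.
    have nF n : nnm (EFin \o \1_(F n) : T -> \bar R).
      by apply: nnm_indic; case: (HF n).
    have [[_ _ _ _ Il] [_ _ _ _ Jl]] := (HI, HJ).
    rewrite FE (Il _ nF ndi) (Jl _ nF ndi).
    by congr (limn _); apply/funext => n; case: (HF n).
apply: (lambda_system_subset GI lH) => //.
- by move=> B GB; split; [rewrite mG; exact: sub_sigma_algebra|exact: IJ].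
- by rewrite -mG.
Unshelve. all: by end_near. Qed.

Lemma integral_like_integral (mu : {measure set T -> \bar R}) (D : set T) :
  measurable D -> integral_like (fun f => \int[mu]_(x in D) f x).
Proof.
move=> mD; split.
- by move=> f [mf f0]; exact: integral_ge0.
- move=> f g [mf f0] [mg g0] fg.
  by apply: ge0_le_integral => //; exact: measurable_funTS.
- move=> f g [mf f0] [mg g0].
  by rewrite ge0_integralD//; exact: measurable_funTS.
- move=> r f r0 [mf f0].
  by rewrite ge0_integralZl//; exact: measurable_funTS.
- move=> f_ nf nd; rewrite monotone_convergence//.
  + by move=> n; have [mf _] := nf n; exact: measurable_funTS.
  + by move=> n x _; have [_] := nf n.
Qed.

Lemma integral_like_weight I (w : T -> R) : integral_like I ->
  measurable_fun setT w -> (forall x, 0 <= w x)%R ->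
  integral_like (fun f => I (fun x => f x * (w x)%:E)).
Proof.
move=> [I0 Ile ID IZ Ilim] mw w0.
have N f : nnm f -> nnm (fun x => f x * (w x)%:E).
  move=> nf; apply: nnmM => //; split; last by move=> x; rewrite lee_fin.
  exact/measurable_EFinP.
split.
- by move=> f nf; exact/I0/N.
- move=> f g nf ng fg; apply: Ile; [exact: N..|].
  by move=> x; rewrite lee_wpmul2r ?lee_fin.
- move=> f g nf ng; rewrite -ID; [|exact: N..].
  congr I; apply/funext => x /=.
  by rewrite ge0_muleDl//; [case: nf|case: ng].
- move=> r f r0 nf; rewrite -IZ//; last exact: N.
  by congr I; apply/funext => x /=; rewrite muleA.
- move=> f_ nf nd; rewrite -Ilim.
  + congr I; apply/funext => x.
    rewrite muleC -limeMl//; last exact: ereal_nondecreasing_is_cvgn.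
    by under eq_fun do rewrite muleC.
  + by move=> n; exact: N.
  + by move=> x a b ab; apply: lee_wpmul2r; rewrite ?lee_fin//; exact: nd.
Qed.

End theory.

Lemma integral_like_comp d (T : measurableType d) d' (T' : measurableType d')
    (I : (T' -> \bar R) -> \bar R) (m : T' -> T) : integral_like I ->
  measurable_fun setT m -> integral_like (fun f => I (f \o m)).
Proof.
move=> [I0 Ile ID IZ Ilim] mm; split.
- by move=> f nf; exact/I0/nnm_comp.
- by move=> f g nf ng fg; apply: Ile; [exact: nnm_comp..|move=> x /=].
- by move=> f g nf ng; rewrite -ID//; exact: nnm_comp.
- by move=> r f r0 nf; rewrite -IZ//; exact: nnm_comp.
- move=> f_ nf nd; rewrite -Ilim//; first by move=> n; exact: nnm_comp.
  by move=> x; exact: nd.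
Qed.

Lemma integral_like_mix d (T : measurableType d) d' (T' : measurableType d')
    (mu : {measure set T' -> \bar R}) (I : T' -> (T -> \bar R) -> \bar R) :
  (forall y, integral_like (I y)) ->
  (forall f, nnm f -> measurable_fun setT (I ^~ f)) ->
  integral_like (fun f => \int[mu]_y I y f).
Proof.
move=> HI mI.
have N f : nnm f -> nnm (I ^~ f).
  by move=> nf; split=> [|y]; [exact: mI|have [+ _ _ _ _] := HI y; exact].
have [J0 Jle JD JZ Jlim] := integral_like_integral mu measurableT.
split.
- by move=> f nf; exact/J0/N.
- move=> f g nf ng fg; apply: Jle; [exact: N..|move=> y].
  by have [_ + _ _ _] := HI y; exact.
- move=> f g nf ng; rewrite -JD; [|exact: N..].
  by apply: eq_integral => y _; have [_ _ + _ _] := HI y; exact.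
- move=> r f r0 nf; rewrite -JZ//; last exact: N.
  by apply: eq_integral => y _; have [_ _ _ + _] := HI y; exact.
- move=> f_ nf nd; rewrite -Jlim; last 2 first.
  + by move=> n; exact: N.
  + move=> y a b ab; have [_ + _ _ _] := HI y.
    by apply=> // x; exact: nd.
  by apply: eq_integral => y _; have [_ _ _ _ +] := HI y; exact.
Qed.

End integral_functionals.

(** * Iterated Lebesgue integrals *)

Section iterated_integrals.
Context {R : realType}.
Implicit Types (k : nat) (x : nat -> R).

(** Events of distribution functions. The set [D] of constrained indices varies freely, which keeps
    the family stable under intersection and includes constraints on a single coordinate. *)
Definition boxes : set (set (nat -> R)) :=
  [set A | exists (D : pred nat) (y : nat -> R),
     A = [set x | forall i, D i -> x i <= y i]].

Local Notation seqm := (g_sigma_algebraType boxes).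

Lemma setI_closed_boxes : setI_closed boxes.
Proof.
move=> _ _ [D1 [y1 ->]] [D2 [y2 ->]].
exists (fun i => D1 i || D2 i).
exists (fun i => if D1 i then if D2 i then Num.min (y1 i) (y2 i) else y1 i else y2 i).
apply/seteqP; split=> [x [/= x1 x2] i|x /= xy].
  have := x1 i; have := x2 i; case: (D1 i); case: (D2 i) => //= h2 h1 _;
    by rewrite ?le_min ?h1 ?h2.
split=> i Di; have := xy i; rewrite Di ?orbT /= => /(_ isT).
- by case: (D2 i); rewrite // le_min => /andP[].
- by case: (D1 i); rewrite // le_min => /andP[].
Qed.

Lemma measurable_coord i : measurable_fun setT (fun x : seqm => x i).
Proof.
apply: (measurability _ (RGenOInfty.measurableE R)) => //= _ [_ [r ->] <-].
rewrite setTI -[X in measurable X]setCK; apply: measurableC.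
apply: sub_sigma_algebra; exists (pred1 i), (fun _ => r).
apply/seteqP; split=> [x /= xr j /eqP ->|x /= /(_ i (eqxx i)) xr].
  by rewrite leNgt; apply/negP => h; apply: xr; rewrite in_itv/= h.
by rewrite in_itv/= andbT => /lt_geF; rewrite xr.
Qed.

Lemma measurable_to_seq d (T : measurableType d) (f : T -> seqm) :
  (forall i, measurable_fun setT (fun t => f t i)) -> measurable_fun setT f.
Proof.
move=> mf; apply: (@measurability _ _ T seqm setT f boxes) => // _ [_ [D [y ->]] <-].
rewrite setTI (_ : _ @^-1` _ = \bigcap_(i in [set i | D i]) [set t | f t i <= y i]).
  apply: bigcap_measurableType => // i _.
  rewrite -[X in measurable X]setTI.
  have -> : [set t | f t i <= y i] = (fun t => f t i) @^-1` `]-oo, y i].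
    by apply/seteqP; split=> t /=; rewrite in_itv.
  exact: mf.
by apply/seteqP; split=> t /= h i Di; exact: h.
Qed.

Definition upd x k (y : R) : nat -> R := fun i => if i == k then y else x i.

Lemma upd_upd x k y z : upd (upd x k y) k z = upd x k z.
Proof. by apply/funext => i; rewrite /upd; case: eqP. Qed.

Lemma upd_comm x j k y z : j != k -> upd (upd x j y) k z = upd (upd x k z) j y.
Proof.
move=> jk; apply/funext => i; rewrite /upd; case: eqP => [->|//].
by rewrite eq_sym (negbTE jk).
Qed.

Lemma measurable_upd k :
  measurable_fun setT (fun p : seqm * R => upd p.1 k p.2 : seqm).
Proof.
apply: measurable_to_seq => i; rewrite /upd; case: eqP => _; first exact: measurable_snd.
exact: (measurableT_comp (measurable_coord i) measurable_fst).
Qed.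

Lemma measurable_updr x k : measurable_fun setT (fun y : R => upd x k y : seqm).
Proof. by apply: measurable_to_seq => i; rewrite /upd; case: eqP. Qed.

(** Tonelli: a partial integral stays measurable in the remaining coordinates, as the next
    integration requires. *)
Lemma nnm_iint k (F : seqm -> \bar R) : nnm F -> nnm (iint k F : seqm -> \bar R).
Proof.
elim: k F => [//|k IH] F nF; split; last first.
  by move=> x /=; apply: integral_ge0 => y _; have [_] := IH F nF; exact.
have [mk k0] := IH F nF.
apply: (@measurable_fun_fubini_tonelli_F _ _ seqm (measurableTypeR R) R lebesgue_measure
  (fun p : seqm * R => iint k F (upd p.1 k.+1 p.2))) => //.
exact: measurableT_comp mk (measurable_upd _).
Qed.

Lemma integral_like_iint k x : integral_like (fun F : seqm -> \bar R => iint k F x).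
Proof.
elim: k x => [|k IH] x /=.
  by split => //= f [_ f0].
apply: integral_like_mix => [y|f nf]; first exact: IH.
have [mk _] := nnm_iint k nf.
exact: measurableT_comp mk (measurable_updr _ _).
Qed.

(** [iint k] varies only the coordinates 1 to [k]; all others keep their value in [x]. *)
Lemma eq_iint k (F G : (nat -> R) -> \bar R) x :
  (forall u, (forall i, ~~ (1 <= i <= k)%N -> u i = x i) -> F u = G u) ->
  iint k F x = iint k G x.
Proof.
elim: k x => [|k IH] x FG /=; first exact: FG.
apply: eq_integral => y _; apply: IH => u ux; apply: FG => i ik.
rewrite ux; last by apply: contra ik => /andP[-> /leqW].
by rewrite /upd; case: eqP ik => // ->; rewrite leqnn.
Qed.

Lemma iint_upd k F x j a : (k < j)%N ->
  iint k F (upd x j a) = iint k (fun u => F (upd u j a)) x.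
Proof.
elim: k x => [//|k IH] x kj /=.
apply: eq_integral => y _.
rewrite -/(upd (upd x j a) k.+1 y) -/(upd x k.+1 y).
by rewrite upd_comm ?gtn_eqF// IH// ltnW.
Qed.

End iterated_integrals.
Notation seqm R := (g_sigma_algebraType (@boxes R)).

(** * Change of variables in iterated integrals *)

Section substitution.
Context {R : realType}.
Local Notation mu := (@lebesgue_measure R).
Implicit Types (h dh hinv : R -> R).

(** Smoothness is required on [0,1] only: this covers both C2 isomorphisms and the Moebius map used
    later, which has a pole at -1. *)
Definition diffeo01 h dh hinv : Prop :=
  [/\ measurable_fun setT h, measurable_fun setT dh, measurable_fun setT hinv,
      (forall x : R, 0 <= x <= 1 ->
        [/\ is_derive x 1 h (dh x), {for x, continuous dh} & 0 < dh x]) &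
      [/\ h 0 = 0, h 1 = 1,
         (forall y : R, 0 <= y <= 1 -> 0 <= hinv y <= 1 /\ h (hinv y) = y) &
         (forall x : R, 0 <= x <= 1 -> 0 <= h x <= 1 /\ hinv (h x) = x)]].

(** Density of the image of Lebesgue measure on ]0,1[ under the inverse of [h]; the indicator
    discards whatever [dh] does elsewhere. *)
Definition jac dh (u : R) : R := \1_(`]0, 1[%classic) u * dh u.

Variables (h dh hinv : R -> R).
Hypothesis dif : diffeo01 h dh hinv.

Lemma diffeo01_continuous (x : R) : 0 <= x <= 1 -> {for x, continuous h}.
Proof.
case: dif => _ _ _ d _ /d[dx _ _].
by apply: differentiable_continuous; apply/derivable1_diffP.
Qed.

Lemma diffeo01_MVT (x y : R) : 0 <= x -> x < y -> y <= 1 ->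
  exists2 c, x < c < y & h y - h x = dh c * (y - x).
Proof.
move=> x0 xy y1; case: (dif) => _ _ _ d _.
have [||c cxy ->] := @MVT R h dh x y xy.
- move=> z; rewrite in_itv/= => /andP[xz zy]; case: (d z) => //.
  by rewrite (ltW (le_lt_trans x0 xz)) (ltW (lt_le_trans zy y1)).
- apply: continuous_in_subspaceT => z; rewrite inE/= in_itv/= => /andP[xz zy].
  by apply: diffeo01_continuous; rewrite (le_trans x0 xz) (le_trans zy y1).
- by exists c => //; move: cxy; rewrite in_itv.
Qed.

Lemma diffeo01_lt (x y : R) : 0 <= x -> x < y -> y <= 1 -> h x < h y.
Proof.
move=> x0 xy y1; have [c /andP[xc cy] e] := diffeo01_MVT x0 xy y1.
rewrite -subr_gt0 e mulr_gt0 ?subr_gt0//.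
case: dif => _ _ _ /(_ c) + _ => -[] //.
by rewrite (ltW (le_lt_trans x0 xc)) (ltW (lt_le_trans cy y1)).
Qed.

Lemma diffeo01_le (x y : R) : 0 <= x -> x <= y -> y <= 1 -> h x <= h y.
Proof.
by move=> x0; rewrite le_eqVlt => /predU1P[->//|xy] y1; apply/ltW/diffeo01_lt.
Qed.

Lemma diffeo01_ltE (x y : R) : 0 <= x <= 1 -> 0 <= y <= 1 -> (h x < h y) = (x < y).
Proof.
move=> /andP[x0 x1] /andP[y0 y1]; apply/idP/idP; last by move=> xy; exact: diffeo01_lt.
by apply: contraTT; rewrite -!leNgt => yx; exact: diffeo01_le.
Qed.

Lemma diffeo01_itv (u : R) : 0 < u < 1 -> 0 < h u < 1.
Proof.
move=> /andP[u0 u1]; case: (dif) => _ _ _ _ [<- <- _ _].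
by rewrite !diffeo01_lt// ?ltW.
Qed.

Lemma jac_ge0 u : 0 <= jac dh u.
Proof.
rewrite /jac indicE; have [|] := boolP (u \in _); last by rewrite mul0r.
rewrite inE/= in_itv/= mul1r => /andP[u0 u1].
have [_ _ _ d _] := dif.
by have /d[_ _ /ltW] : 0 <= u <= 1 by rewrite !ltW.
Qed.

Lemma measurable_jac : measurable_fun setT (jac dh).
Proof.
by apply: measurable_funM; [exact: measurable_indic|case: dif].
Qed.

Lemma integral_derivative (s : R) : 0 <= s < 1 ->
  (\int[mu]_u (\1_(`]s, 1[%classic) u * dh u)%:E = (1 - h s)%:E)%E.
Proof.
move=> /andP[s0 s1]; case: (dif) => _ mdh _ d [_ h1 _ _].
have -> : (\int[mu]_u (\1_(`]s, 1[%classic) u * dh u)%:E =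
    \int[mu]_(u in `]s, 1%R[) (dh u)%:E)%E.
  rewrite [in RHS]integral_mkcond; apply: eq_integral => u _.
  by rewrite patchE indicE; case: ifP => _; rewrite ?mul1r ?mul0r.
rewrite -(@integral_itv_bndoo _ _ _ _ true false); last first.
  exact/measurable_EFinP/measurable_funTS.
have dc z : s <= z <= 1 -> [/\ is_derive z 1 h (dh z), {for z, continuous dh} & 0 < dh z].
  by move=> /andP[sz z1]; apply: d; rewrite (le_trans s0).
rewrite (@continuous_FTC2 R dh h)//.
- by rewrite h1.
- apply: continuous_in_subspaceT => z; rewrite inE/= in_itv/= => zs.
  by case: (dc z).
- split.
  + move=> z; rewrite in_itv/= => /andP[sz z1]; case: (dc z) => //.
    by rewrite !ltW.
  + by apply: cvg_at_right_filter; apply: diffeo01_continuous; rewrite s0 ltW.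
  + by apply: cvg_at_left_filter; apply: diffeo01_continuous; rewrite ler01 lexx.
- move=> z; rewrite in_itv/= => /andP[sz z1]; case: (dc z); first by rewrite !ltW.
  by move=> dz _ _; rewrite derive1E derive_val.
Qed.

(** Both sides are integral functionals of [phi] with mass 1, so rays ]r, +oo[ suffice. For r in
    [0,1[ the right-hand side integrates h' from h^-1(r) to 1, which the fundamental theorem of
    calculus evaluates. *)
Lemma integral_subst01 (phi : R -> \bar R) : nnm phi ->
  (\int[mu]_x (phi x * (\1_(`]0, 1[%classic) x)%:E) =
   \int[mu]_u (phi (h u) * (jac dh u)%:E))%E.
Proof.
move: phi; case: (dif) => mh mdh mhi d [h0 h1 hi1 hi2].
have mI : measurable_fun setT (\1_(`]0, 1[%classic) : R -> R).
  exact: measurable_indic.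
have I0 (x : R) : 0 <= (\1_(`]0, 1[%classic) x : R) by rewrite indicE.
have HI := integral_like_weight (integral_like_integral mu measurableT) mI I0.
have HJ := integral_like_comp (integral_like_weight
  (integral_like_integral mu measurableT) measurable_jac jac_ge0) mh.
have int01 (s : R) : 0 <= s < 1 ->
    (\int[mu]_x (\1_(`]s, 1%R[%classic) x)%:E = (1 - s)%:E)%E.
  move=> /andP[s0 s1]; rewrite integral_indic//.
  rewrite setIT; etransitivity; first exact: lebesgue_measure_itv.
  by rewrite /= lte_fin s1 EFinB.
have I1 : (\int[mu]_x (1 * (\1_(`]0%R, 1%R[%classic) x)%:E) = 1%:E)%E.
  under eq_integral do rewrite mul1e.
  by rewrite int01 ?lexx ?ltr01// subr0.
have J1 : (\int[mu]_x (1 * (jac dh x)%:E) = 1%:E)%E.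
  under eq_integral do rewrite mul1e.
  by rewrite integral_derivative ?lexx ?ltr01// h0 subr0.
apply: (integral_like_uniq (RGenOInfty.measurableE R) _ HI HJ); rewrite /= ?I1//.
  move=> _ _ [r ->] [s ->]; exists (Num.max r s).
  apply/seteqP; split=> x /=; rewrite !in_itv/= !andbT gt_max.
    by move=> [-> ->].
  by move=> /andP[].
move=> _ [r ->].
(* A ray from [r >= 1] misses ]0,1[, and [h] maps ]0,1[ into itself: both sides vanish. *)
have [r1|r1] := leP 1 r.
  transitivity (\int[mu]_x (cst 0 x) : \bar R)%E; last apply/esym.
  + apply: eq_integral => x _ /=.
    have [xr|xr] := ltP x 1; last first.
      rewrite [X in (_ * X%:E)%E]indicE memNset ?mule0//= in_itv/= => /andP[_].
      by rewrite ltNge xr.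
    rewrite indicE memNset ?mul0e//= in_itv/= andbT => /(le_lt_trans r1).
    by rewrite ltNge ltW.
  + apply: eq_integral => x _ /=; rewrite /jac.
    have [x01|x01] := pselect ((`]0, 1[%classic : set R) x); last first.
      have -> : \1_(`]0%R, 1%R[%classic) x = 0 :> R by rewrite indicE memNset.
      by rewrite mul0r mule0.
    rewrite indicE memNset ?mul0e//= in_itv/= andbT => /(le_lt_trans r1).
    move: x01; rewrite /= in_itv/= => /diffeo01_itv/andP[_ h1'].
    by rewrite ltNge ltW.
pose m := Num.max r 0.
have m01 : 0 <= m < 1 by rewrite /m le_max lexx orbT gt_max r1 ltr01.
have m01' : 0 <= m <= 1 by case/andP: m01 => -> /ltW ->.
have [s01 hs] := hi1 _ m01'.
have s1 : 0 <= hinv m < 1.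
  case/andP: (s01) => -> s1; rewrite lt_neqAle s1 andbT /=.
  apply/eqP => s1'; move: hs m01; rewrite s1' h1 => <-.
  by rewrite ltxx andbF.
transitivity ((1 - m)%:E : \bar R).
  rewrite -int01//; apply: eq_integral => x _ /=.
  rewrite -EFinM; congr EFin; rewrite !indicE -natrM mulnb; congr (_%:R).
  congr nat_of_bool; apply/andP/idP; rewrite !inE/= !in_itv/= /m gt_max.
    by move=> [/andP[-> _] /andP[-> ->]].
  by move=> /andP[/andP[-> ->] ->].
rewrite -hs -integral_derivative//; apply/esym/eq_integral => x _ /=.
rewrite -EFinM; congr EFin; rewrite /jac mulrA; congr (_ * _).
rewrite !indicE -natrM mulnb; congr (_%:R); congr nat_of_bool.
have s0 : 0 <= hinv m by case/andP: s01.
apply/andP/idP; rewrite !inE/= !in_itv/= ?andbT; last first.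
  move=> /andP[sx x1]; rewrite (le_lt_trans s0 sx) x1; split=> //.
  have : m < h x.
    by rewrite -hs diffeo01_ltE// (ltW (le_lt_trans s0 sx)) ltW.
  by rewrite /m gt_max => /andP[].
move=> [rx /andP[x0 x1]]; rewrite x1 andbT -diffeo01_ltE// ?ltW// hs /m gt_max rx /=.
by have /andP[] : 0 < h x < 1 by apply: diffeo01_itv; rewrite x0.
Qed.

End substitution.

Section iterated_substitution.
Context {R : realType}.
Variables (h dh hinv : R -> R).
Hypothesis dif : diffeo01 h dh hinv.
Implicit Types (k : nat) (x u : nat -> R).

Definition coordwise k u : nat -> R :=
  fun i => if (1 <= i <= k)%N then h (u i) else u i.

Definition cube k u : R := \prod_(1 <= i < k.+1) \1_(`]0, 1[%classic) (u i).

Definition jacs k u : R := \prod_(1 <= i < k.+1) jac dh (u i).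

Lemma measurable_coordwise k :
  measurable_fun setT (coordwise k : seqm R -> seqm R).
Proof.
apply: measurable_to_seq => i; rewrite /coordwise; case: (1 <= i <= k)%N.
  case: dif => mh _ _ _ _.
  exact: (measurableT_comp mh (measurable_coord i)).
exact: measurable_coord.
Qed.

Lemma measurable_jacs k : measurable_fun setT (jacs k : seqm R -> R).
Proof.
apply: measurable_prod => i _.
exact: (measurableT_comp (measurable_jac dif) (measurable_coord i)).
Qed.

Lemma jacs_ge0 k u : 0 <= jacs k u.
Proof. by apply: prodr_ge0 => i _; exact: jac_ge0 dif _. Qed.

Lemma nnm_EFin d (T : measurableType d) (f : T -> R) :
  measurable_fun setT f -> (forall t, 0 <= f t) -> nnm (EFin \o f).
Proof.
by move=> mf f0; split; [exact/measurable_EFinP|move=> t /=; rewrite lee_fin].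
Qed.

Lemma coordwise_upd k u a : coordwise k (upd u k.+1 (h a)) =
  coordwise k.+1 (upd u k.+1 a).
Proof.
apply/funext => i; rewrite /coordwise /upd; have [->|ik] := eqVneq i k.+1.
  by rewrite ltnn andbF leqnn.
by rewrite [(i <= k.+1)%N]leq_eqVlt (negbTE ik).
Qed.

(** Induction on the number of variables: the inductive hypothesis treats the inner [k] variables
    with the last one as a parameter, then the one-dimensional substitution treats the outer
    variable. *)
Lemma iint_subst k (F : seqm R -> \bar R) (x : seqm R) : nnm F ->
  (iint k (fun u : seqm R => F u * (cube k u)%:E) x =
   iint k (fun u : seqm R => F (coordwise k u) * (jacs k u)%:E) x)%E.
Proof.
elim: k F x => [|k IH] F x nF.
  rewrite /= /cube /jacs !big_geq// !mule1; congr F.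
  by apply/funext => i; rewrite /coordwise; case: i.
have nFi : nnm (fun u : seqm R => (F u * (\1_(`]0, 1[%classic) (u k.+1))%:E))%E.
  apply: nnmM => //; apply: (@nnm_EFin _ (seqm R) (fun u => \1_(`]0, 1[%classic) (u k.+1))).
    exact: (measurableT_comp (measurable_indic (measurable_itv _)) (measurable_coord _)).
  by move=> u; rewrite indicE.
pose G u := (F (coordwise k u) * (jacs k u)%:E)%E.
have nG : nnm (G : seqm R -> _).
  apply: nnmM; first exact: (nnm_comp (measurable_coordwise k) nF).
  exact: (nnm_EFin (measurable_jacs k) (jacs_ge0 k)).
have iintZr (c : R) (H : seqm R -> \bar R) (y : seqm R) : 0 <= c -> nnm H ->
    (iint k (fun u => H u * c%:E) y = iint k H y * c%:E)%E.
  move=> c0 nH; have [_ _ _ + _] := @integral_like_iint R k y.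
  move=> /(_ c H c0 nH); rewrite muleC => <-.
  by congr iint; apply/funext => u; rewrite muleC.
pose phi y := iint k G (upd x k.+1 y).
have nphi : nnm phi.
  exact: (nnm_comp (measurable_updr x k.+1) (nnm_iint k nG)).
transitivity (\int[lebesgue_measure]_y (phi y * (\1_(`]0, 1[%classic) y)%:E))%E.
  apply: eq_integral => y _; rewrite -/(upd x k.+1 y).
  transitivity (iint k (fun u => F u * (\1_(`]0, 1[%classic) (u k.+1))%:E *
      (cube k u)%:E) (upd x k.+1 y))%E.
    congr iint; apply/funext => u.
    by rewrite /cube big_nat_recr//= EFinM muleA muleAC.
  rewrite IH// -(iintZr _ _ (upd x k.+1 y) _ nG); last by rewrite indicE.
  apply: eq_iint => u uy; rewrite /G muleAC {2}/coordwise ltnn andbF uy ?ltnn ?andbF//.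
  by rewrite /upd eqxx.
rewrite (integral_subst01 dif nphi); apply: eq_integral => v _.
rewrite -/(upd x k.+1 v) -iintZr//; last exact: (jac_ge0 dif).
(* Writing the update by [h v] over the update by [v] lets [iint_upd] move [h] into the integrand,
   where it completes [coordwise k] to [coordwise k.+1]. *)
rewrite /phi -(upd_upd x k.+1 v (h v)) iint_upd//.
apply: eq_iint => u uv.
have uvE : u k.+1 = v by rewrite uv ?ltnn ?andbF// /upd eqxx.
have uE : u = upd u k.+1 v.
  by apply/funext => i; rewrite /upd; case: eqP => // ->.
rewrite /G coordwise_upd -uE /jacs [in RHS]big_nat_recr//= uvE.
rewrite [X in (_ * X%:E * _)%E](_ : _ = \prod_(1 <= i < k.+1) jac dh (u i)).
  by rewrite -muleA -EFinM.
apply: eq_big_nat => i /andP[_ ik]; rewrite /upd ltn_eqF//.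
Qed.

End iterated_substitution.

(** * The Dirichlet laws *)

Section dirichlet.
Context {R : realType}.
Implicit Types (N : nat) (t x u : nat -> R).

Definition bnd N x i : R := if i == 0%N then 0 else if i == N.+1 then 1 else x i.

Definition simplex N : set (nat -> R) :=
  [set u | forall i, (i <= N)%N -> bnd N u i < bnd N u i.+1].

Lemma bnd0 N u : bnd N u 0 = 0. Proof. by []. Qed.

Lemma bndN1 N u : bnd N u N.+1 = 1. Proof. by rewrite /bnd /= eqxx. Qed.

Lemma bnd_mid N u i : (1 <= i <= N)%N -> bnd N u i = u i.
Proof. by case: i => [//|i] iN; rewrite /bnd /= ltn_eqF// ltnS. Qed.

Lemma simplex_mono N u i j : simplex N u -> (i < j <= N.+1)%N ->
  bnd N u i < bnd N u j.
Proof.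
move=> su /andP[]; elim: j => // j IH; rewrite ltnS leq_eqVlt => /predU1P[->|ij] jN.
  exact: su.
by apply: (lt_trans (IH ij (ltnW jN))); exact: su.
Qed.

Lemma simplex_itv N u i : simplex N u -> (1 <= i <= N)%N -> 0 < u i < 1.
Proof.
move=> su iN; rewrite -(bnd_mid u iN); case/andP: iN => i1 iN.
have := @simplex_mono N u 0 i su; have := @simplex_mono N u i N.+1 su.
rewrite bnd0 bndN1 leqnn ltnS iN i1 => /(_ isT) -> -> //.
by rewrite (leq_trans iN).
Qed.

Lemma simplex_bnd N u i : simplex N u -> (i <= N.+1)%N -> 0 <= bnd N u i <= 1.
Proof.
move=> su; case: i => [_|i iN]; first by rewrite bnd0 lexx ler01.
move: iN; rewrite leq_eqVlt => /predU1P[->|iN].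
  by rewrite bndN1 lexx ler01.
rewrite bnd_mid//; have /andP[i0 i1] := simplex_itv su (i := i.+1) iN.
by rewrite !ltW.
Qed.

Lemma measurable_bnd N i : measurable_fun setT (fun u : seqm R => bnd N u i).
Proof.
rewrite /bnd; case: (i == 0%N) => //; case: (i == N.+1) => //.
exact: measurable_coord.
Qed.

Lemma measurable_simplex N : measurable (simplex N : set (seqm R)).
Proof.
rewrite (_ : simplex N = \bigcap_(i in [set i | (i <= N)%N]) [set u | bnd N u i < bnd N u i.+1]).
  apply: bigcap_measurableType => i _.
  have := measurable_fun_ltr (measurable_bnd N i) (measurable_bnd N i.+1).
  move=> /(_ measurableT [set true] _); rewrite setTI; apply => //.
by apply/seteqP; split=> u h i; exact: h.
Qed.

Section density.
Variables (beta : R) (N : nat) (t : nat -> R).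

Lemma dir_densityE x : dir_density beta N t x =
  \1_(simplex N) x * (Gamma beta / (\prod_(i < N.+1) Gamma (beta * (t i.+1 - t i))) *
    \prod_(i < N.+1) (bnd N x i.+1 - bnd N x i) `^ (beta * (t i.+1 - t i) - 1)).
Proof.
rewrite /dir_density indicE; case: asboolP => sx.
  by rewrite mem_set ?mul1r.
by rewrite memNset ?mul0r.
Qed.

Lemma Gamma_ge0 (s : R) : 0 <= Gamma s.
Proof.
apply/fine_ge0/integral_ge0 => x _; by rewrite lee_fin mulr_ge0 ?powR_ge0// expR_ge0.
Qed.

Lemma dir_density_ge0 x : 0 <= dir_density beta N t x.
Proof.
rewrite dir_densityE; apply: mulr_ge0; first by rewrite indicE.
apply: mulr_ge0; last by apply: prodr_ge0 => i _; exact: powR_ge0.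
apply: divr_ge0; first exact: Gamma_ge0.
by apply: prodr_ge0 => i _; exact: Gamma_ge0.
Qed.

Lemma measurable_dir_density :
  measurable_fun setT (dir_density beta N t : seqm R -> R).
Proof.
rewrite (funext dir_densityE).
apply: measurable_funM; first exact: (measurable_indic (measurable_simplex N)).
apply: measurable_funM => //; apply: measurable_prod => i _.
apply: (measurableT_comp (measurable_powR _)).
by apply: measurable_funB; exact: measurable_bnd.
Qed.

Lemma dir_density_simplex x : dir_density beta N t x != 0 -> simplex N x.
Proof.
apply: contraNP => sx; rewrite dir_densityE indicE memNset ?mul0r//.
Qed.

End density.

Lemma iint0 k (x : nat -> R) : iint k (fun _ => 0%E) x = 0%E.
Proof.
by elim: k x => [//|k IH] x /=; under eq_integral do rewrite IH; exact: integral0.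
Qed.

(** Zero off 1..N, to match the base point [fun _ => 0] of the iterated integral in
    [dirichlet_marginals]. *)
Definition proj N t (g : R -> R) : nat -> R :=
  fun i => if (1 <= i <= N)%N then g (t i) else 0.

Lemma measurable_eval (s : R) : measurable_fun setT (fun g : G0m R => sval g s).
Proof.
by move=> _ B mB; rewrite setTI; apply: sub_sigma_algebra; exists s, B.
Qed.

Lemma measurable_proj N t :
  measurable_fun setT (fun g : G0m R => proj N t (sval g) : seqm R).
Proof.
apply: measurable_to_seq => i; rewrite /proj; case: (_ <= _ <= _)%N => //.
exact: measurable_eval.
Qed.

Lemma G0_itv (g : G0 R) s : 0 <= sval g s <= 1.
Proof.
case: g => g /= [_ g01 _ gl gr]; have [s0|s0] := ltP s 0.
  by rewrite gl// lexx ler01.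
have [s1|s1] := leP 1 s; first by rewrite gr// lexx ler01.
by apply: g01; rewrite s0.
Qed.

Section law.
Variables (beta : R) (Q : probability (G0m R) R).
Hypothesis dQ : dirichlet_marginals beta Q.
Variables (N : nat) (t : nat -> R).
Hypotheses (N0 : (0 < N)%N) (t0 : t 0%N = 0) (tN : t N.+1 = 1).
Hypothesis tlt : forall i, (i <= N)%N -> t i < t i.+1.

(** Boxes form a generating pi-system, and on a box the claim reduces to the distribution functions
    in [dQ]. *)
Lemma dirichlet_law (F : seqm R -> \bar R) : nnm F ->
  (\int[Q]_g F (proj N t (sval g)) =
   iint N (fun x => F x * (dir_density beta N t x)%:E) (fun _ => 0%R))%E.
Proof.
move: F.
have HI := integral_like_comp (integral_like_integral Q measurableT)
  (measurable_proj N t).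
have HJ := integral_like_weight (integral_like_iint N (fun _ => 0))
  (measurable_dir_density beta N t) (dir_density_ge0 beta N t).
have key A : boxes A -> (\int[Q]_g (EFin \o \1_A) (proj N t (sval g)) =
   iint N (fun x => (EFin \o \1_A) x * (dir_density beta N t x)%:E) (fun _ => 0%R))%E.
  move=> [D [y AE]].
  (* Indices of [D] outside 1..N constrain a coordinate that is 0 on both sides: if such a bound is
     negative, both sides vanish; otherwise the constraint is void. *)
  have [Dy|Dy] := pselect (forall i, D i -> ~~ (1 <= i <= N)%N -> 0 <= y i); last first.
    have nA u : (forall i, ~~ (1 <= i <= N)%N -> u i = 0) -> ~ A u.
      move=> u0 Au; apply: Dy => i Di iN; rewrite -(u0 i iN).
      by move: Au; rewrite AE; exact.
    transitivity (\int[Q]_g (cst 0%E) g)%E.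
      apply: eq_integral => g _ /=; rewrite indicE memNset//; apply: nA => i iN.
      by rewrite /proj (negbTE iN).
    rewrite integral0 -[LHS](iint0 N (fun _ => 0)); apply: eq_iint => u u0.
    by rewrite /= indicE memNset ?mul0e//; exact: nA.
  (* All values are at most 1, so the bound 1 stands for an absent constraint. *)
  pose y' i := if D i then y i else 1.
  have AP u : (forall i, ~~ (1 <= i <= N)%N -> u i = 0) ->
      (forall i, (1 <= i <= N)%N -> u i <= 1) ->
      A u <-> (forall i, (1 <= i <= N)%N -> u i <= y' i).
    move=> u0 u1; rewrite AE; split=> /= h i.
      by move=> iN; rewrite /y'; case: ifPn => Di; [exact: h|exact: u1].
    move=> Di; have [iN|iN] := boolP (1 <= i <= N)%N.
      by have := h i iN; rewrite /y' Di.
    by rewrite u0//; exact: Dy.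
  have := dQ N0 t0 tN tlt y'.
  have -> : [set g : G0m R | forall i, (1 <= i <= N)%N -> sval g (t i) <= y' i] =
      (fun g : G0m R => proj N t (sval g)) @^-1` A.
    apply/seteqP; split=> g /= h.
      apply/AP => [i iN|i iN|i iN]; rewrite /proj ?(negbTE iN)// iN//.
        by have /andP[] := G0_itv g (t i).
      exact: h.
    move=> i iN; have /AP := h.
    move=> /(_ _ _ i iN); rewrite {3}/proj iN; apply.
      by move=> j jN; rewrite /proj (negbTE jN).
    by move=> j jN; rewrite /proj jN; have /andP[] := G0_itv g (t j).
  have mA : measurable (A : set (seqm R)).
    by apply: sub_sigma_algebra; exists D, y.
  have mpA : measurable ((fun g : G0m R => proj N t (sval g)) @^-1` A : set (G0m R)).
    by rewrite -[X in measurable X]setTI; exact: measurable_proj.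
  rewrite -[X in Q X]setIT -(integral_indic Q measurableT mpA).
  move=> e; transitivity (\int[Q]_g (\1_((fun g : G0m R => proj N t (sval g)) @^-1` A) g)%:E)%E.
    by apply: eq_integral => g _ /=; rewrite !indicE.
  rewrite e; apply: eq_iint => u u0 /=.
  have [->|/dir_density_simplex su] := eqVneq (dir_density beta N t u) 0.
    by rewrite mul0r mule0.
  rewrite -EFinM mulrC indicE; congr (_ * _)%:E.
  have := AP u u0 (fun i iN => ltW (proj2 (andP (simplex_itv su iN)))).
  case: asboolP => h Ah; first by rewrite mem_set//; exact/Ah.
  by rewrite memNset// => /Ah.
have bT : boxes ([set: nat -> R]).
  by exists pred0, (fun _ => 0); apply/seteqP; split.
have c1 : cst 1%E = EFin \o \1_[set: nat -> R] :> ((nat -> R) -> \bar R).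
  by rewrite indicT.
apply: (@integral_like_uniq R _ (seqm R) (@boxes R) _ _ erefl (@setI_closed_boxes R) HI HJ) => //.
  rewrite (_ : _ \o _ = cst 1%E)// integral_cst// mul1e; exact: fin_num_measure.
by have := key _ bT; rewrite -c1.
Qed.

End law.
End dirichlet.

(** * Finite dimensional quasi-invariance *)

(** Reduction to real powers: squaring makes the base nonnegative, where the power -1 is the
    inverse, and the factor [x] restores the sign. *)
Lemma measurable_invr (R : realType) : measurable_fun setT (fun x : R => x^-1).
Proof.
rewrite (_ : (fun x => _) = fun x : R => x * (x ^+ 2) `^ (-1)).
  apply: measurable_funM => //; apply: (measurableT_comp (measurable_powR _)).
  exact: measurable_funX.
apply/funext => x; rewrite powR_inv1 ?sqr_ge0//.
have [->|x0] := eqVneq x 0; first by rewrite invr0 mul0r.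
by rewrite expr2 invfM mulrA divff// mul1r.
Qed.

Section finite_dimensional_density.
Context {R : realType}.
Implicit Types (N : nat) (t u : nat -> R) (x y : R).
Variables (h dh hinv : R -> R).

(** The diagonal value is the limit of the difference quotient; a path may take equal values at
    consecutive grid points. *)
Definition slope x y := if x < y then (h y - h x) / (y - x) else dh x.

Definition jterm x y := (ln (dh x) + ln (dh y)) / 2 - ln (slope x y).

(* The products of the h' (a i) and of the slopes are regrouped so that each interval
   gets half of the contribution of either end point; the missing halves at 0 and 1
   give the last term. *)
Definition logdens (beta : R) N t (a : nat -> R) : R :=
  \sum_(i < N.+1) beta * (t i.+1 - t i) * ln (slope (a i) (a i.+1)) +
  \sum_(i < N.+1) jterm (a i) (a i.+1) - (ln (dh 0) + ln (dh 1)) / 2.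

Lemma eq_logdens (beta : R) N t (a b : nat -> R) :
  (forall i, (i <= N.+1)%N -> a i = b i) ->
  logdens beta N t a = logdens beta N t b.
Proof.
move=> ab; rewrite /logdens; congr (_ + _ - _); apply: eq_bigr => i _;
  by rewrite !ab// ltnW.
Qed.

Hypothesis dif : diffeo01 h dh hinv.

Lemma measurable_slope d (T : measurableType d) (f g : T -> R) :
  measurable_fun setT f -> measurable_fun setT g ->
  measurable_fun setT (fun z => slope (f z) (g z)).
Proof.
move=> mf mg; have [mh mdh _ _ _] := dif.
apply: measurable_fun_ifT; first exact: measurable_fun_ltr.
  apply: measurable_funM; first by apply: measurable_funB; exact: measurableT_comp.
  apply: (measurableT_comp (@measurable_invr R)).
  exact: measurable_funB.
exact: measurableT_comp.
Qed.

Lemma measurable_jterm d (T : measurableType d) (f g : T -> R) :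
  measurable_fun setT f -> measurable_fun setT g ->
  measurable_fun setT (fun z => jterm (f z) (g z)).
Proof.
move=> mf mg; have [mh mdh _ _ _] := dif.
have mln (k : T -> R) : measurable_fun setT k -> measurable_fun setT (fun z => ln (k z)).
  exact: (measurableT_comp (@measurable_ln R)).
apply: measurable_funB; last exact/mln/measurable_slope.
apply: measurable_funM => //.
by apply: measurable_funD; apply: mln; exact: measurableT_comp.
Qed.

Lemma measurable_logdens d (T : measurableType d) beta N t (f : nat -> T -> R) :
  (forall i, measurable_fun setT (f i)) ->
  measurable_fun setT (fun z => logdens beta N t (f^~ z)).
Proof.
move=> mf; apply: measurable_funB => //; apply: measurable_funD.
  apply: measurable_sum => i; apply: measurable_funM => //.
  apply: (measurableT_comp (@measurable_ln R)); exact: measurable_slope.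
by apply: measurable_sum => i; exact: measurable_jterm.
Qed.

Lemma slope_gt0 x y : 0 <= x <= 1 -> 0 <= y <= 1 -> 0 < slope x y.
Proof.
move=> x01 y01; rewrite /slope; case: ifPn => xy.
  by rewrite divr_gt0// subr_gt0// (diffeo01_ltE dif).
by have [_ _ _ /(_ x x01)[]] := dif.
Qed.

Lemma bnd_coordwise N u i : (forall i, (1 <= i <= N)%N -> 0 < u i < 1) ->
  (i <= N.+1)%N -> bnd N (coordwise h N u) i = h (bnd N u i).
Proof.
move=> u01 iN; have [_ _ _ _ [h0 h1 _ _]] := dif.
rewrite /bnd; case: eqVneq => // i0; case: eqVneq => // iN1.
rewrite /coordwise; move: iN; rewrite leq_eqVlt (negbTE iN1) ltnS /= => ->.
by rewrite lt0n i0.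
Qed.

Lemma dir_density_coordwise beta N t u :
  dir_density beta N t (coordwise h N u) * jacs dh N u =
  expR (logdens beta N t (bnd N u)) * dir_density beta N t u.
Proof.
have [_ _ _ d _] := dif.
have [su|su] := pselect (simplex N u); last first.
  (* Off the simplex both sides vanish: a coordinate outside ]0,1[ kills the Jacobian, and if all
     lie inside, monotonicity of [h] keeps the image off the simplex as well. *)
  rewrite [in RHS]dir_densityE indicE (memNset su) mul0r mulr0.
  have [->|j0] := eqVneq (jacs dh N u) 0; first by rewrite mulr0.
  have u01 i : (1 <= i <= N)%N -> 0 < u i < 1.
    move=> iN; apply: contraNP j0 => ui; rewrite /jacs prodf_seq_eq0.
    apply/hasP; exists i; first by rewrite mem_index_iota ltnS.
    rewrite /= /jac indicE memNset ?mul0r// => h01; apply: ui.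
  rewrite dir_densityE indicE memNset ?mul0r// => sc; apply: su => i iN.
  have b01 j : (j <= N.+1)%N -> 0 <= bnd N u j <= 1.
    move=> jN; rewrite /bnd; case: eqVneq => [_|j0']; first by rewrite lexx ler01.
    case: eqVneq => [_|jN']; first by rewrite lexx ler01.
    have /andP[u0 u1] : 0 < u j < 1.
      apply: u01; rewrite lt0n j0' /=.
      by move: jN; rewrite leq_eqVlt (negbTE jN') ltnS.
    by rewrite !ltW.
  have := sc i iN; rewrite !bnd_coordwise// ?(leq_trans iN)//.
  by rewrite (diffeo01_ltE dif)// b01// (leq_trans iN).
have u01 i : (1 <= i <= N)%N -> 0 < u i < 1 by exact: simplex_itv.
have b01 i : (i <= N.+1)%N -> 0 <= bnd N u i <= 1 by exact: simplex_bnd.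
have sc : simplex N (coordwise h N u).
  move=> i iN; rewrite !bnd_coordwise// ?(leq_trans iN)//.
  by rewrite (diffeo01_ltE dif) ?b01// ?(leq_trans iN)//; exact: su.
rewrite !dir_densityE !indicE !mem_set// !mul1r.
set C := _ / _.
(* Each image increment is the slope times the old increment, so its power splits off a power of the
   slope. *)
have -> : \prod_(i < N.+1) (bnd N (coordwise h N u) i.+1 -
      bnd N (coordwise h N u) i) `^ (beta * (t i.+1 - t i) - 1) =
  expR (\sum_(i < N.+1) (beta * (t i.+1 - t i) - 1) *
    ln (slope (bnd N u i) (bnd N u i.+1))) *
  \prod_(i < N.+1) (bnd N u i.+1 - bnd N u i) `^ (beta * (t i.+1 - t i) - 1).
  rewrite expR_sum -big_split/=; apply: eq_bigr => i _.
  have iN : (i.+1 <= N.+1)%N := ltn_ord i.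
  have iN' := ltnW iN.
  rewrite !bnd_coordwise//.
  have bi : bnd N u i < bnd N u i.+1 by apply: su; rewrite -ltnS.
  have s0 : 0 < slope (bnd N u i) (bnd N u i.+1).
    by apply: slope_gt0; apply: b01; rewrite // ltnW.
  rewrite -[X in X `^ _](_ : slope (bnd N u i) (bnd N u i.+1) *
      (bnd N u i.+1 - bnd N u i) = _); last first.
    by rewrite /slope bi divfK// subr_eq0 gt_eqF.
  rewrite powRM ?(ltW s0)// ?subr_ge0 ?ltW//; congr (_ * _).
  by rewrite /powR gt_eqF.
have -> : jacs dh N u = expR (\sum_(1 <= i < N.+1) ln (dh (bnd N u i))).
  rewrite expR_sum /jacs; apply: eq_big_nat => i; rewrite ltnS => iN.
  have ui := u01 i iN; rewrite bnd_mid// /jac indicE mem_set ?mul1r; last first.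
    by rewrite /= in_itv.
  by rewrite lnK// posrE; case: (d (u i)) => //; case/andP: ui => ? ?; rewrite !ltW.
set P := \prod_(i < N.+1) _.
suff -> : expR (logdens beta N t (bnd N u)) =
    expR (\sum_(i < N.+1) (beta * (t i.+1 - t i) - 1) *
      ln (slope (bnd N u i) (bnd N u i.+1))) *
    expR (\sum_(1 <= i < N.+1) ln (dh (bnd N u i))) by ring.
apply/esym; rewrite -expRD; congr expR; rewrite /logdens /jterm.
have -> : \sum_(i < N.+1) (beta * (t i.+1 - t i) - 1) * ln (slope (bnd N u i) (bnd N u i.+1)) =
  \sum_(i < N.+1) beta * (t i.+1 - t i) * ln (slope (bnd N u i) (bnd N u i.+1)) -
  \sum_(i < N.+1) ln (slope (bnd N u i) (bnd N u i.+1)).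
  by rewrite -sumrB; apply: eq_bigr => i _; rewrite mulrBl mul1r.
rewrite sumrB -mulr_suml big_split/=.
rewrite [X in (X + _) / 2]big_ord_recl [X in (_ + X) / 2]big_ord_recr/= bnd0 bndN1.
rewrite big_add1 /= big_mkord.
set S := \sum_(i < N) ln (dh (bnd N u (bump 0 i))).
by field.
Qed.

Section law.
Variables (beta : R) (Q : probability (G0m R) R).
Hypothesis dQ : dirichlet_marginals beta Q.
Variables (N : nat) (t : nat -> R).
Hypotheses (N0 : (0 < N)%N) (t0 : t 0%N = 0) (tN : t N.+1 = 1).
Hypothesis tlt : forall i, (i <= N)%N -> t i < t i.+1.

Lemma coordwiseK u : (forall i, (1 <= i <= N)%N -> 0 < u i < 1) ->
  coordwise hinv N (coordwise h N u) = u.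
Proof.
have [_ _ _ _ [_ _ _ hK]] := dif.
move=> u01; apply/funext => i; rewrite /coordwise; case: ifPn => iN; last by rewrite (negbTE iN).
have ui : 0 <= u i <= 1 by have /andP[? ?] := u01 i iN; rewrite !ltW.
by rewrite iN; have [_ ->] := hK _ ui.
Qed.

(** The marginal law turns both sides into iterated integrals; substituting [h] in the coordinates
    cancels [hinv] and produces the Jacobian that [dir_density_coordwise] absorbs. *)
Lemma dirichlet_quasi_invariant (F : seqm R -> \bar R) : nnm F ->
  (\int[Q]_g F (coordwise hinv N (proj N t (sval g))) =
   \int[Q]_g (F (proj N t (sval g)) *
     (expR (logdens beta N t (bnd N (proj N t (sval g)))))%:E))%E.
Proof.
move=> nF; have [mh _ mhi _ _] := dif.
pose W u := expR (logdens beta N t (bnd N u)).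
have nW : nnm (EFin \o W : seqm R -> _).
  apply: (@nnm_EFin _ _ (seqm R)) => [|u]; last exact: expR_ge0.
  apply: (measurableT_comp (@measurable_expR R)).
  by apply: measurable_logdens => i; exact: measurable_bnd.
have mci : measurable_fun setT (coordwise hinv N : seqm R -> seqm R).
  apply: measurable_to_seq => i; rewrite /coordwise; case: (1 <= i <= N)%N.
    exact: (measurableT_comp mhi (measurable_coord i)).
  exact: measurable_coord.
have nFc := nnm_comp mci nF.
have ndens : nnm (EFin \o dir_density beta N t : seqm R -> _).
  apply: (@nnm_EFin _ _ (seqm R)); [exact: measurable_dir_density|exact: dir_density_ge0].
rewrite (dirichlet_law dQ N0 t0 tN tlt nFc).
rewrite (dirichlet_law dQ N0 t0 tN tlt (nnmM nF nW)).
(* The cube indicator comes for free, the Dirichlet density being supported in the simplex. *)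
transitivity (iint N (fun u => F (coordwise hinv N u) *
    (dir_density beta N t u)%:E * (cube N u)%:E)%E (fun _ => 0)).
  congr iint; apply/funext => u /=.
  have [->|/dir_density_simplex su] := eqVneq (dir_density beta N t u) 0.
    by rewrite mule0 mul0e.
  rewrite [cube N u](_ : _ = 1) ?mule1// /cube big_nat_cond big1// => i.
  rewrite andbT ltnS => iN; rewrite indicE mem_set//= in_itv/=.
  exact: (simplex_itv su iN).
have nG : nnm (fun u : seqm R =>
    (F (coordwise hinv N u) * (dir_density beta N t u)%:E)%E).
  exact: nnmM nFc ndens.
etransitivity; first exact: (iint_subst dif N (fun _ => 0) nG).
congr iint; apply/funext => u /=.
rewrite -muleA -EFinM dir_density_coordwise -muleA -EFinM.
have [->|/dir_density_simplex su] := eqVneq (dir_density beta N t u) 0.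
  by rewrite mulr0 !mule0.
by rewrite coordwiseK// => i iN; exact: (simplex_itv su iN).
Qed.

End law.
End finite_dimensional_density.

(** * Paths in G0 and their behaviour at the end points *)

Section G0_paths.
Context {R : realType}.
Variable g : G0 R.
Local Notation f := (sval g).

(** The normalisation by 0 on the left and 1 on the right makes monotonicity global, so left limits
    exist at every point, 0 and 1 included. *)
Lemma G0_nondecreasing : {homo f : s t / s <= t}.
Proof.
move=> s t st; have [fm f01 _ fl fr] := svalP g.
have [s0|s0] := ltP s 0; first by rewrite fl//; case/andP: (G0_itv g t).
have [t1|t1] := leP 1 t; first by rewrite (fr t)//; case/andP: (G0_itv g s).
have t0 := le_trans s0 st; have s1 := le_lt_trans st t1.
by apply: fm => //; rewrite in_itv/= ?s0 ?t0.
Qed.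

Lemma lft_cvg a : f x @[x --> a^'-] --> lft f a.
Proof.
apply: nondecreasing_at_left_is_cvgr.
  by apply: nearW => x y z _ _; exact: G0_nondecreasing.
apply: nearW => x; exists 1 => _ [y _ <-].
by have /andP[] := G0_itv g y.
Qed.

Lemma lft_ge x a : x < a -> f x <= lft f a.
Proof.
move=> xa; apply: limr_ge; first exact: lft_cvg.
near=> y; apply: G0_nondecreasing; near: y; exact: nbhs_left_ge.
Unshelve. all: by end_near. Qed.

Lemma lft_le a : lft f a <= f a.
Proof.
apply: limr_le; first exact: lft_cvg.
near=> y; apply: G0_nondecreasing; near: y; exact: nbhs_left_le.
Unshelve. all: by end_near. Qed.

Lemma lft_itv a : 0 <= lft f a <= 1.
Proof.
apply/andP; split; last by apply: (le_trans (lft_le a)); case/andP: (G0_itv g a).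
by apply: (le_trans _ (@lft_ge (a - 1) a _)); [case/andP: (G0_itv g (a - 1))|rewrite gtrBl].
Qed.

Lemma G0_right_cvg a : f x @[x --> a^'+] --> f a.
Proof.
have [_ _ rc fl fr] := svalP g.
have [a0|a0] := ltP a 0.
  apply: cvg_near_cst; near=> x.
  have x0 : x < 0 by near: x; exact: nbhs_right_lt.
  by rewrite !fl.
have [a1|a1] := leP 1 a; last by apply: rc; rewrite a0.
apply: cvg_near_cst; near=> x.
have ax : a <= x by near: x; exact: nbhs_right_ge.
by rewrite !fr// (le_trans a1).
Unshelve. all: by end_near. Qed.

Lemma rgtE a : rgt f a = f a.
Proof. by apply: cvg_lim => //; exact: G0_right_cvg. Qed.

Lemma lft_cvg_seq a (u : nat -> R) : (forall n, u n < a) -> u n @[n --> \oo] --> a ->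
  f (u n) @[n --> \oo] --> lft f a.
Proof. by move=> ua uc; move/cvg_at_leftP : (lft_cvg (a := a)); apply. Qed.

Lemma right_cvg_seq a (u : nat -> R) : (forall n, a <= u n) -> u n @[n --> \oo] --> a ->
  f (u n) @[n --> \oo] --> f a.
Proof.
move=> ua uc; apply/cvgrPdist_le => e e0.
have := @G0_right_cvg a; move/cvgrPdist_le => /(_ _ e0) h.
have [d /= d0 hd] := h.
move/cvgrPdist_lt : uc => /(_ _ d0); apply: filterS => n un.
have := ua n; rewrite le_eqVlt => /predU1P[<-|au]; first by rewrite subrr normr0 ltW.
by apply: hd => //.
Qed.

End G0_paths.

Lemma measurable_lft (R : realType) (a : R) :
  measurable_fun setT (fun g : G0m R => lft (sval g) a).
Proof.
apply: (measurable_fun_cvg (h := fun n (g : G0m R) => sval g (a - n.+1%:R^-1))).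
  by move=> n; exact: measurable_eval.
move=> g _; apply: lft_cvg_seq => [n|]; first by rewrite gtrBl.
rewrite -[X in _ --> X]subr0; apply: cvgB; first exact: cvg_cst.
exact: cvg_harmonic.
Qed.

(** * Almost sure boundary values through a Moebius test map *)

Section moebius.
Context {R : realType}.
Implicit Types (x y : R).

(* The Moebius map 2 x / (1 + x): its slope is the geometric mean of the derivatives
   at the end points, so that jterm vanishes and the density is explicit. *)
Definition mob x : R := 2 - 2 * (1 + x)^-1.
Definition dmob x : R := 2 * ((1 + x)^-1 * (1 + x)^-1).
Definition imob y : R := y * (2 - y)^-1.

Lemma mob_diffeo01 : diffeo01 mob dmob imob.
Proof.
have mi (k : R -> R) : measurable_fun setT k -> measurable_fun setT (fun x => (k x)^-1).
  by move=> mk; apply: (measurableT_comp (@measurable_invr R)).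
have m1 : measurable_fun setT (fun x : R => (1 + x)^-1) by apply: mi; exact: measurable_funD.
split.
- by apply: measurable_funB => //; exact: measurable_funM.
- by apply: measurable_funM => //; exact: measurable_funM.
- by apply: measurable_funM => //; apply: mi; exact: measurable_funB.
- move=> x /andP[x0 x1]; have x10 : 1 + x != 0 by rewrite gt_eqF// ltr_pwDl.
  have cV : {for x, continuous (fun x : R => (1 + x)^-1)}.
    by apply: cvgV => //; apply: cvgD; [exact: cvg_cst|exact: cvg_id].
  split.
  + have d1 : is_derive x 1 (fun x : R => 1 + x) 1.
      have := is_deriveD (is_derive_cst (1 : R) x 1) (is_derive_id x 1).
      by rewrite add0r.
    have dV := is_deriveV x10 d1.
    apply: is_derive_eq.
    by rewrite /dmob /GRing.scale/= add0r mul1r !mulr1 mulrN opprK -exprVn expr2.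
  + by apply: cvgM; [exact: cvg_cst|exact: cvgM].
  + by rewrite /dmob !mulr_gt0// invr_gt0 ltr_pwDl.
split.
- by rewrite /mob addr0 invr1 mulr1 subrr.
- by rewrite /mob; field.
- move=> y /andP[y0 y1]; have y2 : 0 < 2 - y by lra.
  have y2' : 2 - y != 0 by rewrite gt_eqF.
  have i0 : 0 <= imob y by rewrite /imob mulr_ge0// invr_ge0 ltW.
  have i1 : imob y <= 1 by rewrite /imob ler_pdivrMr//; lra.
  split; first by rewrite i0.
  have : 1 + imob y != 0 by rewrite gt_eqF// ltr_pwDl// /imob mulr_ge0// invr_ge0 ltW.
  rewrite /mob /imob => e; field; rewrite y2' /=.
  by move: e; apply: contra => /eqP e; apply/eqP; field: e.
- move=> x /andP[x0 x1]; have x10 : 0 < 1 + x by lra.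
  have x10' : 1 + x != 0 by rewrite gt_eqF.
  have -> : mob x = 2 * x / (1 + x) by rewrite /mob; field.
  have m0 : 0 <= 2 * x / (1 + x) by rewrite divr_ge0 ?mulr_ge0// ltW.
  have m1' : 2 * x / (1 + x) <= 1 by rewrite ler_pdivrMr//; lra.
  split; first by rewrite m0.
  by rewrite /imob; field; rewrite x10'/=; lra.
Qed.

Lemma ln_slope_mob x y : 0 <= x -> x <= y ->
  ln (slope mob dmob x y) = ln 2 - ln (1 + x) - ln (1 + y).
Proof.
move=> x0 xy; have x10 : 0 < 1 + x by lra.
have y10 : 0 < 1 + y by lra.
have -> : slope mob dmob x y = 2 / (1 + x) / (1 + y).
  rewrite /slope; case: ifPn => [xy'|].
    have x1' : 1 + x != 0 by rewrite gt_eqF.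
    have y1' : 1 + y != 0 by rewrite gt_eqF.
    have yx : y - x != 0 by rewrite subr_eq0 gt_eqF.
    by rewrite /mob; field; rewrite yx x1' y1'.
  rewrite -leNgt => yx; have -> : y = x by apply/eqP; rewrite eq_le yx xy.
  by rewrite /dmob mulrA.
by rewrite !ln_div// posrE// divr_gt0.
Qed.

Variables (beta : R) (Q : probability (G0m R) R).
Hypotheses (b0 : 0 < beta) (dQ : dirichlet_marginals beta Q).

(* Letting s tend to 0 and to 1 yields g(0) = 0 and g(1-) = 1 almost surely. *)
Lemma expectation_moebius s : 0 < s < 1 ->
  (\int[Q]_g (expR (- beta * ln (1 + sval g s)))%:E =
   (expR (- beta * (s * ln 2)))%:E)%E.
Proof.
move=> /andP[s0 s1].
(* One interior point [s]; with the integrand 1 the finite-dimensional identity says that the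
   density has mean 1. *)
pose t i : R := if i == 0%N then 0 else if i == 1%N then s else 1.
have tlt i : (i <= 1)%N -> t i < t i.+1 by case: i => [|[|]].
have := @dirichlet_quasi_invariant R mob dmob imob mob_diffeo01 beta Q dQ 1 t
  isT erefl erefl tlt (cst 1%E) (nnm_cst _ lee01).
have -> : (\int[Q]_g cst 1 (coordwise imob 1 (proj 1 t (sval g))) = 1)%E.
  by rewrite integral_cst// mul1e; exact: probability_setT.
have mE : measurable_fun setT (fun g : G0m R => expR (- beta * ln (1 + sval g s))).
  apply: (measurableT_comp (@measurable_expR R)); apply: measurable_funM => //.
  apply: (measurableT_comp (@measurable_ln R)); apply: measurable_funD => //.
  exact: measurable_eval.
have -> : (\int[Q]_g (cst 1 (proj 1 t (sval g)) *
    (expR (logdens mob dmob beta 1 t (bnd 1 (proj 1 t (sval g)))))%:E) =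
  \int[Q]_g ((expR (beta * (s * ln 2)))%:E * (expR (- beta * ln (1 + sval g s)))%:E))%E.
  (* Here h'(0) h'(1) = 2 * (1/2) = 1 and both [jterm] vanish; the weights s and 1 - s of ln (1 +
     g(s)) add up to 1. *)
  apply: eq_integral => g _; rewrite /= mul1e -EFinM -expRD; congr (expR _)%:E.
  have /andP[g0 g1] := G0_itv g s.
  rewrite /logdens /jterm !big_ord_recr !big_ord0/= /bnd /proj/= /t/=.
  rewrite !ln_slope_mob// /dmob !addr0 invr1 !mulr1.
  have -> : ln (2 * ((1 + 1)^-1 * (1 + 1)^-1)) = - ln 2 :> R.
    by rewrite -lnV ?posrE//; congr ln; field.
  have -> : ln (2 * ((1 + sval g s)^-1 * (1 + sval g s)^-1)) = ln 2 - 2 * ln (1 + sval g s).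
    have p : 0 < 1 + sval g s by rewrite ltr_pwDl.
    by rewrite mulrA !ln_div ?posrE ?divr_gt0//; ring.
  rewrite ln1.
  by field.
have mE' : measurable_fun setT (fun g : G0m R =>
    (expR (- beta * ln (1 + sval g s)))%:E) by exact/measurable_EFinP.
rewrite ge0_integralZl//=.
move=> e.
by rewrite -[RHS]mule1 e muleA -EFinM -expRD mulNr addNr expR0 mul1e.
Qed.

Lemma measurable_expln (k : G0m R -> R) : measurable_fun setT k ->
  measurable_fun setT (fun g => expR (- beta * ln (1 + k g))).
Proof.
move=> mk; apply: (measurableT_comp (@measurable_expR R)); apply: measurable_funM => //.
apply: (measurableT_comp (@measurable_ln R)); exact: measurable_funD.
Qed.

Lemma expln_le x y : 0 <= x -> x <= y ->
  expR (- beta * ln (1 + y)) <= expR (- beta * ln (1 + x)).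
Proof.
move=> x0 xy; rewrite ler_expR ler_nM2l ?oppr_lt0// ler_ln ?posrE; [|lra..].
by rewrite lerD2l.
Qed.

Lemma expln_inj x y : 0 <= x -> 0 <= y ->
  expR (- beta * ln (1 + y)) = expR (- beta * ln (1 + x)) -> x = y.
Proof.
move=> x0 y0 /expR_inj /mulfI; rewrite oppr_eq0 gt_eqF// => /(_ isT).
by move=> /ln_inj; rewrite !posrE => /(_ _ _)/addrI ->; lra.
Qed.

(** The nonnegative function l - k has integral at most 0; the bound by 1 gives integrability. *)
Lemma ae_eq_integral_le d (T : measurableType d) (P : probability T R)
    (k l : T -> R) : measurable_fun setT k -> measurable_fun setT l ->
  (forall g, 0 <= k g) -> (forall g, k g <= l g) -> (forall g, l g <= 1) ->
  (\int[P]_g (l g)%:E <= \int[P]_g (k g)%:E)%E ->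
  {ae P, forall g, k g = l g}.
Proof.
move=> mk ml k0 kl l1 lk.
have bint (f : T -> R) : measurable_fun setT f -> (forall g, 0 <= f g <= 1) ->
    P.-integrable setT (EFin \o f).
  move=> mf f01; apply: (le_integrable measurableT _ _
    (finite_measure_integrable_cst P 1 measurableT)); first exact/measurable_EFinP.
  move=> g _ /=; rewrite lee_fin normr1.
  by case/andP: (f01 g) => f0 f1; rewrite ger0_norm.
have ik : P.-integrable setT (EFin \o k).
  by apply: bint => // g; rewrite k0 (le_trans (kl g)).
have il : P.-integrable setT (EFin \o l).
  by apply: bint => // g; rewrite l1 (le_trans (k0 g)).
have mlk : measurable_fun setT (fun g => ((l g)%:E - (k g)%:E)%E).
  by apply: emeasurable_funB; exact/measurable_EFinP.
have lk0 g : (0 <= (l g)%:E - (k g)%:E)%E by rewrite -EFinB lee_fin subr_ge0.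
have /(ae_eq_integral_abs _ measurableT mlk) :
    (\int[P]_g `|(l g)%:E - (k g)%:E| = 0)%E.
  under eq_integral do rewrite gee0_abs//.
  apply/eqP; rewrite eq_le; apply/andP; split; last exact: integral_ge0.
  rewrite integralB_EFin// sube_le0//.
apply: filterS => g /(_ Logic.I) /= [/eqP]; rewrite subr_eq0 => /eqP.
by move=> ->.
Qed.

Lemma expln_bounds x : 0 <= x ->
  0 <= expR (- beta * ln (1 + x)) <= 1.
Proof.
move=> x0; rewrite expR_ge0/=.
by have := expln_le (lexx 0) x0; rewrite addr0 ln1 mulr0 expR0.
Qed.

Lemma expR_affine_continuous (c : R) : continuous (fun s : R => expR (- beta * (s * c))).
Proof.
move=> s; apply: (@cvg_comp _ _ _ (fun s => - beta * (s * c)) expR _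
  (nbhs (- beta * (s * c)))); last exact: continuous_expR.
by apply: cvgM; [exact: cvg_cst|apply: cvgM; [exact: cvg_id|exact: cvg_cst]].
Qed.

Lemma expR_limit_at0 (c : R) (z : \bar R) :
  (forall s : R, (0 < s < 1)%R -> ((expR (- beta * (s * c)))%:E <= z)%E) ->
  (1%:E <= z)%E.
Proof.
case: z => [z||] h; last 2 first.
- by rewrite leey.
- have h0 : 0 < (2^-1 : R) by lra.
  have h1 : (2^-1 : R) < 1 by lra.
  by have := h 2^-1; rewrite h0 h1 => /(_ isT); rewrite leeNy_eq.
rewrite lee_fin -expR0 -(mulr0 (- beta)) -{1}(mul0r c).
have : expR (- beta * (s * c)) @[s --> (0 : R)^'+] --> expR (- beta * (0 * c)).
  by apply: cvg_at_right_filter; exact: expR_affine_continuous.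
move=> /cvg_lim <-//; apply: limr_le.
  by apply/cvg_ex; eexists; apply: cvg_at_right_filter; exact: expR_affine_continuous.
near=> s; rewrite -lee_fin; apply: h; apply/andP; split.
  by near: s; exact: nbhs_right_gt.
by near: s; exact: nbhs_right_lt.
Unshelve. all: by end_near. Qed.

Lemma expR_limit_at1 (c : R) (z : \bar R) :
  (forall s : R, (0 < s < 1)%R -> (z <= (expR (- beta * (s * c)))%:E)%E) ->
  (z <= (expR (- beta * c))%:E)%E.
Proof.
case: z => [z||] h; last 2 first.
- have h0 : 0 < (2^-1 : R) by lra.
  have h1 : (2^-1 : R) < 1 by lra.
  by have := h 2^-1; rewrite h0 h1 => /(_ isT); rewrite leye_eq.
- by rewrite leNye.
rewrite lee_fin -{1}(mul1r c).
have : expR (- beta * (s * c)) @[s --> (1 : R)^'-] --> expR (- beta * (1 * c)).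
  by apply: cvg_at_left_filter; exact: expR_affine_continuous.
move=> /cvg_lim <-//; apply: limr_ge.
  by apply/cvg_ex; eexists; apply: cvg_at_left_filter; exact: expR_affine_continuous.
near=> s; rewrite -lee_fin; apply: h; apply/andP; split.
  by near: s; exact: nbhs_left_gt.
by near: s; exact: nbhs_left_lt.
Unshelve. all: by end_near. Qed.

(** As g(0) <= g(s), the mean of (1 + g(0))^-beta is at least 2^(-beta s) for every s in ]0,1[,
    hence at least 1, while the variable itself is at most 1. *)
Lemma G0_at0 : {ae Q, forall g : G0m R, sval g 0 = 0}.
Proof.
have mE := measurable_expln (@measurable_eval R 0).
have g0 (g : G0m R) : 0 <= sval g 0 by case/andP: (G0_itv g 0).
suff : {ae Q, forall g : G0m R, expR (- beta * ln (1 + sval g 0)) = cst 1 g}.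
  apply: filterS => g /= kg.
  by apply/esym/expln_inj => //; rewrite kg addr0 ln1 mulr0 expR0.
apply: ae_eq_integral_le => //=.
  by move=> g; case/andP: (expln_bounds (g0 g)).
rewrite integral_cst// mul1e [leLHS]probability_setT.
apply: (@expR_limit_at0 (ln 2)) => s s01.
rewrite -(expectation_moebius s01).
apply: ge0_le_integral => //.
- by apply/measurable_EFinP; exact: (measurable_expln (@measurable_eval R s)).
- exact/measurable_EFinP.
- move=> g _; rewrite lee_fin expln_le//; apply: G0_nondecreasing.
  by case/andP: s01 => /ltW.
Qed.

(** As g(s) <= g(1-), the mean of (1 + g(1-))^-beta is at most 2^(-beta s), hence at most 2^-beta,
    which bounds the variable from below. *)
Lemma G0_lft1 : {ae Q, forall g : G0m R, lft (sval g) 1 = 1}.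
Proof.
have mE := measurable_expln (@measurable_lft R 1).
have g0 (g : G0m R) : 0 <= lft (sval g) 1 <= 1 by exact: lft_itv.
have e2 : 0 <= expR (- beta * ln 2) <= 1.
  by have := @expln_bounds 1 ler01.
suff : {ae Q, forall g : G0m R,
    cst (expR (- beta * ln 2)) g = expR (- beta * ln (1 + lft (sval g) 1))}.
  apply: filterS => g /= kg.
  by apply/expln_inj => //; case/andP: (g0 g).
apply: ae_eq_integral_le => //=.
- by move=> g; case/andP: (g0 g) => ? ?; exact: (@expln_le _ 1).
- by move=> g; case/andP: (g0 g) => /expln_bounds/andP[].
rewrite integral_cst// [X in (_ <= _ * X)%E]probability_setT mule1.
apply: expR_limit_at1 => s s01.
rewrite -(expectation_moebius s01).
apply: ge0_le_integral => //.
- exact/measurable_EFinP.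
- by apply/measurable_EFinP; exact: (measurable_expln (@measurable_eval R s)).
- move=> g _; rewrite lee_fin expln_le//; first by case/andP: (G0_itv g s).
  by apply: lft_ge; case/andP: s01.
Qed.

End moebius.

(** * Estimates for C2 isomorphisms *)

Section ln_estimates.
Context {R : realType}.
Implicit Types (a b m x y : R).

Lemma ln_le_sub1 x : 0 < x -> ln x <= x - 1.
Proof. by move=> x0; rewrite -{1}(subrKC 1 x) le_ln1Dx// ltrBrDl subrr. Qed.

(** The inequality ln z <= z - 1 at z = a / b and at z = b / a. *)
Lemma ln_lip m a b : 0 < m -> m <= a -> m <= b -> `|ln a - ln b| <= `|a - b| / m.
Proof.
move=> m0.
have key x y : m <= x -> m <= y -> ln x - ln y <= `|x - y| / m.
  move=> mx my; have x0 := lt_le_trans m0 mx; have y0 := lt_le_trans m0 my.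
  rewrite -ln_div ?posrE//; apply: (le_trans (ln_le_sub1 _)); first exact: divr_gt0.
  have -> : x / y - 1 = (x - y) / y by rewrite mulrBl divff// gt_eqF.
  apply: (@le_trans _ _ (`|x - y| / y)).
    by rewrite ler_pM2r ?invr_gt0// ler_norm.
  by rewrite ler_wpM2l// lef_pV2 ?posrE.
move=> ma mb; rewrite ler_norml key// andbT lerNl opprB distrC; exact: key.
Qed.

(** With A the arithmetic mean, the difference is half the logarithm of ab / A^2, and A^2 - ab = (a
    - b)^2 / 4; hence the factor 8. *)
Lemma ln_mean_bounds m a b : 0 < m -> m <= a -> m <= b ->
  `|(ln a + ln b) / 2 - ln ((a + b) / 2)| <= (a - b) ^+ 2 / (8 * m ^+ 2).
Proof.
move=> m0 ma mb; have a0 := lt_le_trans m0 ma; have b0 := lt_le_trans m0 mb.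
have ab0 : 0 < (a + b) / 2 by lra.
have A0 : (a + b) / 2 != 0 by rewrite gt_eqF.
have a0' : a != 0 by rewrite gt_eqF.
have b0' : b != 0 by rewrite gt_eqF.
have [A AE] : exists A : R, A = (a + b) / 2 by exists ((a + b) / 2).
rewrite -AE in ab0 A0 *.
have e : (ln a + ln b) / 2 - ln A = ln ((a * b) / (A * A)) / 2.
  by rewrite ln_div ?posrE ?mulr_gt0// !lnM ?posrE//; field.
have e' : - ln ((a * b) / (A * A)) = ln ((A * A) / (a * b)).
  by rewrite !ln_div ?posrE ?mulr_gt0//; ring.
rewrite e ler_norml; apply/andP; split.
  rewrite -lerN2 opprK -mulNr e'.
  have := @ln_le_sub1 ((A * A) / (a * b)); rewrite divr_gt0 ?mulr_gt0// => /(_ isT) h.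
  apply: (@le_trans _ _ ((a - b) ^+ 2 / (8 * (a * b)))).
    have <- : ((A * A) / (a * b) - 1) / 2 = (a - b) ^+ 2 / (8 * (a * b)).
      by rewrite AE; field; rewrite a0' b0'.
    by rewrite ler_pM2r.
  rewrite ler_wpM2l ?sqr_ge0// lef_pV2 ?posrE ?mulr_gt0// ler_pM2l// expr2.
  by rewrite ler_pM// ltW.
have h : ln ((a * b) / (A * A)) <= 0.
  apply: (le_trans (ln_le_sub1 _)); first by rewrite divr_gt0 ?mulr_gt0.
  rewrite subr_le0 ler_pdivrMr ?mulr_gt0// mul1r -subr_ge0.
  have -> : A * A - a * b = ((a - b) / 2) ^+ 2 by rewrite AE; field.
  exact: sqr_ge0.
apply: (@le_trans _ _ 0); first by lra.
by rewrite divr_ge0 ?sqr_ge0// mulr_ge0// sqr_ge0.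
Qed.

Lemma dist_between (d y u v z : R) : `|y - u| < d -> `|y - v| < d ->
  u < z -> z < v -> `|y - z| < d.
Proof.
by rewrite !ltr_norml => /andP[? ?] /andP[? ?] ? ?; apply/andP; split; lra.
Qed.

Lemma dist_le_double (e y u v : R) : `|y - u| < e -> `|y - v| < e -> v - u <= 2 * e.
Proof. by rewrite !ltr_norml => /andP[? ?] /andP[? ?]; lra. Qed.

Lemma scaled_le_half (eps K w : R) : 0 < eps -> 0 <= K ->
  w <= 2 * (eps / (4 * (K + 1))) -> w * K <= eps / 2.
Proof.
move=> e0 K0 /(ler_wpM2r K0) /le_trans; apply.
have K1 : K + 1 != 0 by rewrite gt_eqF// ltr_wpDl.
have -> : 2 * (eps / (4 * (K + 1))) * K = eps / 2 * (K / (K + 1)) by field.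
rewrite ler_piMr//; first by rewrite divr_ge0// ltW.
by rewrite ler_pdivrMr ?ltr_wpDl// mul1r lerDl.
Qed.

Lemma half_dist_le (c x y : R) : x < c < y -> `|(c - x) / 2| <= (y - x) / 2.
Proof. by move=> /andP[? ?]; rewrite ger0_norm; lra. Qed.

End ln_estimates.

Section C2_estimates.
Context {R : realType}.
Variable h : R -> R.
Hypothesis C2h : isC2 h.
Local Notation dh := (derive1 h).
Local Notation ddh := (derive1 (derive1 h)).
Implicit Types (x y : R).

Lemma C2_is_derive x : is_derive x 1 h (dh x).
Proof.
have [d _ _] := C2h; rewrite derive1E; exact/derivableP.
Qed.

Lemma C2_is_derive1 x : is_derive x 1 dh (ddh x).
Proof.
have [_ d _] := C2h; rewrite [ddh x]derive1E; exact/derivableP.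
Qed.

Lemma C2_continuous : continuous h.
Proof.
move=> x; apply: differentiable_continuous; apply/derivable1_diffP.
by have [d _ _] := C2h.
Qed.

Lemma C2_continuous1 : continuous dh.
Proof.
move=> x; apply: differentiable_continuous; apply/derivable1_diffP.
by have [_ d _] := C2h.
Qed.

Lemma C2_MVT x y : x < y -> exists2 c, x < c < y & h y - h x = dh c * (y - x).
Proof.
move=> xy; have [||c cxy e] := @MVT R h dh x y xy; last by exists c.
  by move=> z _; exact: C2_is_derive.
by apply: continuous_subspaceT; exact: C2_continuous.
Qed.

Lemma C2_MVT1 x y : x < y -> exists2 c, x < c < y & dh y - dh x = ddh c * (y - x).
Proof.
move=> xy; have [||c cxy e] := @MVT R dh ddh x y xy; last by exists c.
  by move=> z _; exact: C2_is_derive1.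
by apply: continuous_subspaceT; exact: C2_continuous1.
Qed.

(** Mean value theorem for the error function [E], which vanishes at [x], then for h' between [x]
    and [c]. A difference of two values of h'' gives a bound and, by continuity, smallness on short
    intervals. *)
Lemma trapezoid_error x y : x < y -> exists c e : R, [/\ x < c < y, x < e < y &
  (dh x + dh y) / 2 - (h y - h x) / (y - x) = (c - x) / 2 * (ddh c - ddh e)].
Proof.
move=> xy.
pose E (z : R) : R := (z - x) * ((dh x + dh z) / 2) - (h z - h x).
pose E' (z : R) : R := (dh x + dh z) / 2 + (z - x) * (ddh z / 2) - dh z.
have dE (z : R) : is_derive z 1 E (E' z).
  have d1 := C2_is_derive z; have d2 := C2_is_derive1 z.
  apply: is_derive_eq.
  rewrite /E' /GRing.scale/=; ring.
have cE : continuous E.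
  move=> z; apply: differentiable_continuous; apply/derivable1_diffP.
  by case: (dE z).
have [c cxy e] := @MVT R E E' x y xy (fun z _ => dE z) (continuous_subspaceT cE).
move: cxy; rewrite in_itv/= => /andP[xc cy].
have [e' /andP[xe ec] ee] := C2_MVT1 xc.
exists c, e'; split; [by rewrite xc|by rewrite xe (lt_trans ec)|].
have yx : y - x != 0 by rewrite subr_eq0 gt_eqF.
have : E' c = (c - x) / 2 * (ddh c - ddh e').
  have -> : E' c = (c - x) * (ddh c / 2) - (dh c - dh x) / 2 by rewrite /E'; field.
  by rewrite ee; move: (ddh c) (ddh e') => p q; ring.
move=> <-; apply: (mulIf yx); rewrite -e /E subrr mul0r; field.
by rewrite yx.
Qed.

Lemma bounded_on01 (f : R -> R) : continuous f ->
  exists2 B : R, 0 < B & forall x, 0 <= x <= 1 -> `|f x| <= B.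
Proof.
move=> cf; have cn : {within `[0, 1], continuous (fun x => `|f x|)}.
  apply: continuous_subspaceT => x; apply: cvg_norm; exact: cf.
have [c _ hc] := EVT_max ler01 cn.
exists (`|f c| + 1); first by rewrite ltr_wpDl.
by move=> x x01; rewrite (le_trans (hc x _)) ?in_itv// lerDl.
Qed.

End C2_estimates.

Section C2_isomorphism.
Context {R : realType}.
Variable h : R -> R.
Hypothesis C2h : C2_isomorphism h.
Local Notation dh := (derive1 h).
Local Notation ddh := (derive1 (derive1 h)).
Implicit Types (x y : R).

Lemma C2_isomorphism_C2 : isC2 h. Proof. by case: C2h. Qed.

(** A bound M on the derivative of the inverse forces the mean slopes of [h] to be at least 1/M, so
    every interval contains a point with h' >= 1/M; continuity of h' extends this to all points, end
    points included. *)
Lemma C2_isomorphism_lower : exists2 m : R, 0 < m & forall x, 0 <= x <= 1 -> m <= dh x.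
Proof.
have [C2 h0 h1 hm [hi [C2i hi1 hi2]]] := C2h.
have [M M0 hM] := bounded_on01 (C2_continuous1 C2i).
exists M^-1; first by rewrite invr_gt0.
have key x y : 0 <= x -> x < y -> y <= 1 -> exists2 c, x < c < y & M^-1 <= dh c.
  move=> x0 xy y1; have [c cxy e] := C2_MVT C2 xy; exists c => //.
  have x01 : 0 <= x <= 1 by rewrite x0 (le_trans (ltW xy)).
  have y01 : 0 <= y <= 1 by rewrite y1 (le_trans x0 (ltW xy)).
  have hxy : h x < h y by apply: hm => //; rewrite in_itv/= ?x01 ?y01.
  have [d /andP[dx dy] e'] := C2_MVT C2i hxy.
  move: e'; rewrite (hi2 x x01).2 (hi2 y y01).2 => e'.
  have d01 : 0 <= d <= 1.
    have /andP[hx0 _] := (hi2 x x01).1; have /andP[_ hy1] := (hi2 y y01).1.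
    by rewrite (ltW (le_lt_trans hx0 dx)) (ltW (lt_le_trans dy hy1)).
  rewrite -(ler_pM2r (_ : 0 < M * (y - x))); last by rewrite mulr_gt0 ?subr_gt0.
  rewrite mulKf ?gt_eqF//.
  have -> : dh c * (M * (y - x)) = M * (dh c * (y - x)) by ring.
  rewrite -e e' ler_wpM2r ?subr_ge0 ?(ltW hxy)//.
  exact: le_trans (ler_norm _) (hM d d01).
move=> x /andP[x0 x1]; rewrite leNgt; apply/negP => hx.
have := C2_continuous1 C2 (x := x) => /cvgr_lt /(_ _ hx)[e /= e0 he].
(* The test interval has to stay inside [0,1]: it is taken to the right of [x], except at 1. *)
have [x1'|x1'] := ltP x 1.
  pose y := Num.min 1 (x + e).
  have xy : x < y by rewrite lt_min x1' ltrDl.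
  have [c /andP[xc cy]] := key x y x0 xy ltac:(by rewrite ge_min lexx).
  apply/negP; rewrite -ltNge; apply: he => /=.
  rewrite ltr_distlC (lt_le_trans _ (ltW xc)) ?gtrBl//=.
  by apply: (lt_le_trans cy); rewrite ge_min lexx orbT.
pose y := Num.max 0 (1 - e).
have y1 : y < 1 by rewrite gt_max ltr01 gtrBl.
have [c /andP[yc c1]] := key y 1 ltac:(by rewrite le_max lexx) y1 (lexx 1).
apply/negP; rewrite -ltNge; apply: he => /=.
have -> : x = 1 by apply/eqP; rewrite eq_le x1 x1'.
rewrite ltr_distlC (lt_trans c1) ?ltrDl// andbT.
by apply: le_lt_trans yc; rewrite le_max lexx orbT.
Qed.

Lemma C2_isomorphism_diffeo01 : exists hinv : R -> R, [/\ diffeo01 h dh hinv, continuous hinv &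
  {in `[0, 1] &, {homo hinv : x y / x <= y}}].
Proof.
have [C2 h0 h1 hm [hi [C2i hi1 hi2]]] := C2h.
have [m m0 hmb] := C2_isomorphism_lower.
exists hi; split; last 2 first.
- exact: C2_continuous.
- move=> x y; rewrite !in_itv/= => x01 y01 xy; rewrite leNgt; apply/negP => yx.
  have [iy ey] := hi1 y y01; have [ix ex] := hi1 x x01.
  have : h (hi y) < h (hi x) by apply: hm => //; rewrite in_itv.
  by rewrite ex ey ltNge xy.
split => //.
- by apply: continuous_measurable_fun; exact: C2_continuous.
- by apply: continuous_measurable_fun; exact: C2_continuous1.
- by apply: continuous_measurable_fun; exact: C2_continuous.
- move=> x x01; split; [exact: C2_is_derive|exact: C2_continuous1|].
  exact: lt_le_trans m0 (hmb x x01).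
Qed.

Lemma C2_slope_MVT x y : 0 <= x -> x <= y -> y <= 1 ->
  exists2 c, x <= c <= y & slope h dh x y = dh c.
Proof.
move=> x0; rewrite le_eqVlt /slope => /predU1P[->|xy] y1.
  by rewrite ltxx; exists y => //; rewrite lexx.
rewrite xy; have [c /andP[xc cy] e] := C2_MVT C2_isomorphism_C2 xy.
by exists c; [rewrite !ltW|rewrite e mulfK// subr_eq0 gt_eqF].
Qed.

Lemma jterm_xx x : jterm h dh x x = 0.
Proof. by rewrite /jterm /slope ltxx; field. Qed.

(** The logarithm of (h'(x) + h'(y)) / 2 is inserted: its distance to the mean of the logarithms is
    quadratic in y - x, and its distance to the logarithm of the slope is at most the trapezoid
    error over [m]. Keeping [c] and [e] explicit serves both the O and the o estimate. *)
Lemma jterm_local : exists m B : R, [/\ 0 < m, 0 < B,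
   (forall x, 0 <= x <= 1 -> m <= dh x <= B),
   (forall x, 0 <= x <= 1 -> `|ddh x| <= B) &
   forall x y, 0 <= x -> x < y -> y <= 1 -> exists c e, [/\ x < c < y, x < e < y &
     `|jterm h dh x y| <= (y - x) * (`|ddh c - ddh e| / (2 * m) +
        (y - x) * (B ^+ 2 / (8 * m ^+ 2)))]].
Proof.
have C2 := C2_isomorphism_C2.
have [m m0 hm] := C2_isomorphism_lower.
have [B1 B10 hB1] := bounded_on01 (C2_continuous1 C2).
have cdd : continuous ddh by case: C2.
have [B2 B20 hB2] := bounded_on01 cdd.
exists m, (B1 + B2); split => //; first exact: addr_gt0.
- move=> x x01; rewrite hm//= (le_trans (ler_norm _))// (le_trans (hB1 x x01))//.
  by rewrite lerDl ltW.
- by move=> x x01; rewrite (le_trans (hB2 x x01))// lerDr ltW.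
move=> x y x0 xy y1; have [c [e [xcy xey he]]] := trapezoid_error C2 xy.
exists c, e; split => //.
have x01 : 0 <= x <= 1 by rewrite x0 (le_trans (ltW xy)).
have y01 : 0 <= y <= 1 by rewrite y1 (le_trans x0 (ltW xy)).
have mx := hm x x01; have my := hm y y01.
have mA : m <= (dh x + dh y) / 2 by move: mx my; move: (dh x) (dh y) => p q; clear; lra.
have [d /andP[xd dy] sd] := C2_slope_MVT x0 (ltW xy) y1.
have d01 : 0 <= d <= 1 by rewrite (le_trans x0)// (le_trans dy).
have mq : m <= slope h dh x y by rewrite sd; exact: hm.
have -> : jterm h dh x y = ((ln (dh x) + ln (dh y)) / 2 - ln ((dh x + dh y) / 2)) +
    (ln ((dh x + dh y) / 2) - ln (slope h dh x y)) by rewrite /jterm; ring.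
rewrite (le_trans (ler_normD _ _))// addrC mulrDr lerD//.
- apply: (le_trans (ln_lip m0 mA mq)); rewrite {1}/slope xy he normrM.
  have yx : 0 < y - x by rewrite subr_gt0.
  have cx := half_dist_le xcy.
  have -> : (y - x) * (`|ddh c - ddh e| / (2 * m)) =
    (y - x) / 2 * `|ddh c - ddh e| / m by field; rewrite gt_eqF.
  by rewrite ler_pM2r ?invr_gt0// ler_wpM2r.
- apply: (le_trans (ln_mean_bounds m0 mx my)).
  have [z /andP[xz zy] ez] := C2_MVT1 C2 xy.
  rewrite -sqrrN opprB ez exprMn.
  have -> : (y - x) * ((y - x) * ((B1 + B2) ^+ 2 / (8 * m ^+ 2))) =
     (B1 + B2) ^+ 2 * (y - x) ^+ 2 / (8 * m ^+ 2) by ring.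
  rewrite ler_pM2r ?invr_gt0 ?mulr_gt0 ?exprn_gt0//.
  rewrite ler_wpM2r ?sqr_ge0// -real_normK ?num_real//.
  have zB : `|ddh z| <= B1 + B2.
    apply: (@le_trans _ _ B2); last by rewrite lerDr ltW.
    by apply: hB2; rewrite (le_trans x0 (ltW xz)) (le_trans (ltW zy)).
  by rewrite lerXn2r ?nnegrE// (le_trans _ zB).
Qed.

Lemma jterm_bounds : exists m B K : R, [/\ 0 < m, 0 < B, 0 < K,
   (forall x, 0 <= x <= 1 -> m <= dh x <= B /\ `|ddh x| <= B) &
   forall x y, 0 <= x -> x <= y -> y <= 1 -> `|jterm h dh x y| <= K * (y - x)].
Proof.
have [m [B [m0 B0 hm hB hj]]] := jterm_local.
exists m, B, (2 * B / (2 * m) + B ^+ 2 / (8 * m ^+ 2)); split => //.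
- by rewrite addr_gt0 ?divr_gt0 ?mulr_gt0 ?exprn_gt0.
- by move=> x x01; split; [exact: hm|exact: hB].
move=> x y x0; rewrite le_eqVlt => /predU1P[->|xy] y1.
  by rewrite jterm_xx normr0 subrr mulr0.
have [c [e [/andP[xc cy] /andP[xe ey] h1]]] := hj x y x0 xy y1.
apply: (le_trans h1); rewrite mulrC ler_wpM2r ?subr_ge0 ?(ltW xy)// lerD//.
  rewrite ler_pM2r ?invr_gt0 ?mulr_gt0// (le_trans (ler_normB _ _))//.
  have -> : 2 * B = B + B by ring.
  by rewrite lerD// hB// (le_trans x0 (ltW _))//= (le_trans (ltW _) y1).
rewrite ler_piMl//; last by rewrite lerBlDr (le_trans y1)// lerDl.
by rewrite divr_ge0 ?sqr_ge0// mulr_ge0// sqr_ge0.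
Qed.

(** The value 0 is the limit at the diagonal, by the o(y - x) estimate. *)
Definition jratio x y : R := if x < y then jterm h dh x y / (y - x) else 0.

Lemma jratioE x y : x <= y -> jratio x y * (y - x) = jterm h dh x y.
Proof.
rewrite /jratio le_eqVlt => /predU1P[->|xy]; first by rewrite ltxx mul0r jterm_xx.
by rewrite xy divfK// subr_eq0 gt_eqF.
Qed.

(** Off the diagonal by composition of continuous maps; on it because the two points of
    [jterm_local] are squeezed to [y] and h'' is continuous. *)
Lemma jratio_cvg (u v : nat -> R) x y : (forall n, 0 <= u n) -> (forall n, u n < v n) ->
  (forall n, v n <= 1) -> 0 <= x -> x <= y -> y <= 1 ->
  u n @[n --> \oo] --> x -> v n @[n --> \oo] --> y ->
  jratio (u n) (v n) @[n --> \oo] --> jratio x y.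
Proof.
move=> u0 uv v1 x0 xy y1 ux vy; have C2 := C2_isomorphism_C2.
have [m m0 hm] := C2_isomorphism_lower.
have pos z : 0 <= z <= 1 -> 0 < dh z by move=> z01; exact: lt_le_trans m0 (hm z z01).
rewrite {1}/jratio; under eq_fun do rewrite uv.
move: xy; rewrite le_eqVlt => /predU1P[xyE|xy]; last first.
  have x01 : 0 <= x <= 1 by rewrite x0 (le_trans (ltW xy)).
  have y01 : 0 <= y <= 1 by rewrite y1 (le_trans x0 (ltW xy)).
  have yx : y - x != 0 by rewrite subr_eq0 gt_eqF.
  have vu : (v n - u n) @[n --> \oo] --> y - x by exact: cvgB.
  have lncomp (w : nat -> R) (z : R) : 0 < z -> w n @[n --> \oo] --> z ->
      ln (w n) @[n --> \oo] --> ln z.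
    by move=> z0 wz; apply: (cvg_comp _ _ wz); exact: continuous_ln.
  rewrite /jratio xy; apply: cvgM; last exact: cvgV.
  rewrite /jterm /slope; under eq_fun do rewrite uv.
  rewrite xy; apply: cvgB.
    apply: cvgM; last exact: cvg_cst.
    by apply: cvgD; apply: lncomp; rewrite ?pos//;
      apply: continuous_cvg => //; exact: C2_continuous1.
  apply: lncomp.
    have [d /andP[xd dy] sd] := C2_slope_MVT x0 (ltW xy) y1.
    by move: sd; rewrite /slope xy => ->; rewrite pos// (le_trans x0)// (le_trans dy).
  apply: cvgM; last exact: cvgV.
  by apply: cvgB; apply: continuous_cvg => //; exact: C2_continuous.
rewrite /jratio xyE ltxx.
have [m' [B [m'0 B0 hm' hB hj]]] := jterm_local.
pose K := B ^+ 2 / (8 * m' ^+ 2).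
have K0 : 0 <= K by rewrite divr_ge0 ?sqr_ge0// mulr_ge0// sqr_ge0.
have cdd : continuous ddh by case: C2.
apply/cvgr0Pnorm_le => eps e0.
(* Two deviations of this size add up to eps * m', which the factor 1 / (2 * m') turns into eps / 2;
   the quadratic term takes the other half. *)
have e1 : 0 < eps * m' / 2 by rewrite divr_gt0 ?mulr_gt0.
have := cdd y; move/cvgrPdist_le => /(_ _ e1)[d /= d0 hd].
have d1 : 0 < Num.min d (eps / (4 * (K + 1))).
  by rewrite lt_min d0 divr_gt0// mulr_gt0// ltr_wpDl.
have un : \forall n \near \oo, `|y - u n| < Num.min d (eps / (4 * (K + 1))).
  by move: ux; rewrite xyE => /cvgrPdist_lt; apply.
have vn : \forall n \near \oo, `|y - v n| < Num.min d (eps / (4 * (K + 1))).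
  by move/cvgrPdist_lt : vy; apply.
near=> n.
have un' : `|y - u n| < Num.min d (eps / (4 * (K + 1))) by near: n.
have vn' : `|y - v n| < Num.min d (eps / (4 * (K + 1))) by near: n.
move: un' vn'; rewrite !lt_min => /andP[ud ue] /andP[vd ve].
have [c [e [/andP[uc cv] /andP[ue' ev] h1]]] := hj (u n) (v n) (u0 n) (uv n) (v1 n).
have vun : 0 < v n - u n by rewrite subr_gt0.
rewrite normrM normfV (gtr0_norm vun) ler_pdivrMr//.
apply: (le_trans h1); rewrite mulrC ler_wpM2r ?(ltW vun)//.
have near_y' := dist_between ud vd.
have dd : `|ddh c - ddh e| <= eps * m'.
  rewrite [leRHS]splitr (le_trans (ler_distD (ddh y) _ _))// lerD//.
    by rewrite distrC; apply: hd => /=; exact: near_y'.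
  by apply: hd => /=; exact: near_y'.
have vuK := scaled_le_half e0 K0 (dist_le_double ue ve).
have ddm : `|ddh c - ddh e| / (2 * m') <= eps / 2.
  rewrite ler_pdivrMr ?mulr_gt0//.
  by rewrite mulrA divfK.
by rewrite -/K [leRHS]splitr lerD.
Unshelve. all: by end_near. Qed.

End C2_isomorphism.

(** * Step functions and dyadic grids *)

Section step_functions.
Context {R : realType}.
Local Notation mu := (@lebesgue_measure R).
Implicit Types (u x y : R).

Lemma lebesgue_itv (i : interval R) : (mu : {measure set _ -> \bar R}) [set` i] =
  (if (i.1 < i.2)%E then ((i.2 : \bar R) - i.1)%E else 0%E).
Proof. exact: lebesgue_measure_itv. Qed.

(** Open on the left and closed on the right, so that consecutive intervals are disjoint without
    leaving gaps, and equal end points give the empty set. *)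
Definition ocind x y u : R := \1_(`]x, y]%classic) u.

Lemma ocindE x y u : ocind x y u = ((x < u) && (u <= y))%:R.
Proof.
by rewrite /ocind indicE; congr (_%:R); congr nat_of_bool; apply/idP/idP;
  rewrite inE/= in_itv.
Qed.

Lemma integrable_bounded01 (k : R -> R) (K : R) : measurable_fun setT k ->
  (forall u, `|k u| <= K) -> mu.-integrable `[0, 1] (EFin \o k).
Proof.
move=> mk hk; apply: measurable_bounded_integrable => //.
- by rewrite lebesgue_itv/= lte_fin ltr01 -EFinB ltry.
- exact: measurable_funTS.
- exists K; split; first exact: num_real.
  by move=> M KM u _ /=; apply: (le_trans (hk u)); exact: ltW.
Qed.

Lemma measurable_ocind x y : measurable_fun setT (ocind x y).
Proof. exact: measurable_indic. Qed.

Lemma Rintegral_ocind c x y : 0 <= x -> x <= y -> y <= 1 ->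
  Rintegral mu `[0, 1] (fun u => ocind x y u * c) = (y - x) * c.
Proof.
move=> x0 xy y1; rewrite RintegralZr//; last first.
  apply: (integrable_bounded01 (measurable_ocind x y) (K := 1)) => u.
  by rewrite ocindE; case: (_ && _); rewrite ?normr1 ?normr0.
congr (_ * _); rewrite /Rintegral /ocind integral_indic//.
rewrite (_ : _ `&` _ = `]x, y]%classic); last first.
  apply/seteqP; split=> u /=; rewrite !in_itv/=; first by case.
  by move=> /andP[xu uy]; rewrite xu uy (ltW (le_lt_trans x0 xu)) (le_trans uy).
rewrite lebesgue_itv/= lte_fin; move: xy; rewrite le_eqVlt => /predU1P[->|xy].
  by rewrite ltxx subrr.
by rewrite xy.
Qed.

Lemma Rintegral_step (I : eqType) (s : seq I) (x y c : I -> R) :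
  (forall i, i \in s -> [/\ 0 <= x i, x i <= y i & y i <= 1]) ->
  Rintegral mu `[0, 1] (fun u => \sum_(i <- s) ocind (x i) (y i) u * c i) =
  \sum_(i <- s) (y i - x i) * c i.
Proof.
elim: s => [_|i s IH hs].
  rewrite big_nil; under eq_Rintegral do rewrite big_nil.
  by rewrite Rintegral_cst// mul0r.
have hi : [/\ 0 <= x i, x i <= y i & y i <= 1] by apply: hs; rewrite mem_head.
have b1 j u : `|ocind (x j) (y j) u * c j| <= `|c j|.
  by rewrite ocindE; case: (_ && _); rewrite ?mul1r ?mul0r ?normr0.
have mt j : measurable_fun setT (fun u => ocind (x j) (y j) u * c j).
  by apply: measurable_funM => //; exact: measurable_ocind.
under eq_Rintegral do rewrite big_cons.
rewrite big_cons RintegralD//; last 2 first.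
- exact: (integrable_bounded01 (mt i) (b1 i)).
- apply: (@integrable_bounded01 _ (\sum_(j <- s) `|c j|)).
    by apply: measurable_sum => j; exact: mt.
  by move=> u; apply: (le_trans (ler_norm_sum _ _ _)); exact: ler_sum.
rewrite IH; last by move=> j js; apply: hs; rewrite inE js orbT.
by case: hi => ? ? ?; rewrite Rintegral_ocind.
Qed.

Lemma sum_at_most_one (I : eqType) (s : seq I) (F : I -> R) j : uniq s -> j \in s ->
  (forall i, i \in s -> i != j -> F i = 0) -> \sum_(i <- s) F i = F j.
Proof.
move=> us js h; rewrite (bigD1_seq j)//= big_seq_cond big1 ?addr0// => i /andP[]; exact: h.
Qed.

Lemma step_value (M : nat) (b c : nat -> R) j u :
  (forall i k, (i <= k <= M)%N -> b i <= b k) -> (j < M)%N -> b j < u <= b j.+1 ->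
  \sum_(i < M) ocind (b i) (b i.+1) u * c i = c j.
Proof.
move=> hb jM /andP[bj uj]; rewrite (bigD1 (Ordinal jM))//= ocindE bj uj mul1r.
rewrite big1 ?addr0// => i ij; rewrite ocindE.
have : (i : nat) != j by apply: contra ij => /eqP e; apply/eqP/val_inj.
rewrite neq_ltn => /orP[ltij|ltji].
  have h1 : b i.+1 <= b j by apply: hb; rewrite ltij ltnW.
  by rewrite [u <= _]leNgt (le_lt_trans h1 bj) andbF mul0r.
have h1 : b j.+1 <= b i by apply: hb; rewrite ltji ltnW.
by rewrite ltNge (le_trans uj h1) mul0r.
Qed.

Lemma step_value0 (M : nat) (b c : nat -> R) u :
  (forall i k, (i <= k <= M)%N -> b i <= b k) -> (u <= b 0%N) || (b M < u) ->
  \sum_(i < M) ocind (b i) (b i.+1) u * c i = 0.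
Proof.
move=> hb hu; rewrite big1// => i _; rewrite ocindE.
have h0 : b 0%N <= b i by apply: hb => /=; exact/ltnW.
have h1 : b i.+1 <= b M by apply: hb; rewrite ltn_ord leqnn.
case/orP: hu => hu; first by rewrite ltNge (le_trans hu h0) mul0r.
by rewrite [u <= _]leNgt (le_lt_trans h1 hu) andbF mul0r.
Qed.

(** Dominated convergence off a countable, hence null, set: it will hold jump times in one use and
    lower ends of jumps in another. *)
Lemma bounded_cvg_Rintegral (F_ : nat -> R -> R) (F : R -> R) (K : R) (N0 : set R) :
  (forall n, measurable_fun setT (F_ n)) -> measurable_fun setT F ->
  (forall n u, `|F_ n u| <= K) -> countable N0 ->
  (forall u, 0 <= u <= 1 -> ~ N0 u -> F_ n u @[n --> \oo] --> F u) ->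
  Rintegral mu `[0, 1] (F_ n) @[n --> \oo] --> Rintegral mu `[0, 1] F.
Proof.
move=> mF_ mF hK cN FF.
have m01 : measurable (`[0, 1]%classic : set R) by exact: measurable_itv.
have mE (k : R -> R) : measurable_fun setT k ->
    measurable_fun (`[0, 1]%classic : set R) (EFin \o k).
  by move=> mk; apply/measurable_EFinP/measurable_funTS.
have iK : mu.-integrable (`[0, 1]%classic : set R) (EFin \o cst K).
  by apply: (@integrable_bounded01 _ `|K|) => // u.
have [] := @dominated_convergence _ _ R mu _ m01 (fun n => EFin \o F_ n) (EFin \o F)
  (EFin \o cst K) (fun n => mE _ (mF_ n)) (mE _ mF) _ iK _.
- exists N0; split; [exact: countable_measurable|exact: countable_lebesgue_measure0|].
  move=> u /= hu; apply: contrapT => nu; apply: hu => u01.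
  have u01' : 0 <= u <= 1 by move: u01; rewrite /= in_itv.
  have FFu := FF u u01' nu.
  by apply/cvg_EFin; [exact: nearW|].
- by apply: aeW => u n _ /=; rewrite lee_fin.
move=> iF _ cv.
rewrite /Rintegral; apply: fine_cvg; rewrite fineK//.
exact: integrable_fin_num.
Qed.

End step_functions.

Section dyadics.
Context {R : realType}.

Definition dyad n i : R := i%:R / 2 ^+ n.

Lemma dyad_lt n i j : (dyad n i < dyad n j) = (i < j)%N.
Proof. by rewrite /dyad ltr_pM2r ?invr_gt0 ?exprn_gt0// ltr_nat. Qed.

Lemma dyad_le n i j : (dyad n i <= dyad n j) = (i <= j)%N.
Proof. by rewrite /dyad ler_pM2r ?invr_gt0 ?exprn_gt0// ler_nat. Qed.

Lemma dyad0 n : dyad n 0 = 0. Proof. by rewrite /dyad mul0r. Qed.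

Lemma dyad1 n : dyad n (2 ^ n) = 1.
Proof. by rewrite /dyad natrX divff// expf_neq0. Qed.

Lemma dyad_itv n i : (i <= 2 ^ n)%N -> 0 <= dyad n i <= 1.
Proof. by move=> iN; rewrite -(dyad0 n) -(dyad1 n) !dyad_le iN. Qed.

Lemma dyad_step n i : dyad n i.+1 - dyad n i = (2 ^+ n)^-1.
Proof. by rewrite /dyad -mulrBl -natrB// subSnn mul1r. Qed.

Lemma dyad_index n s : 0 < s -> exists i, dyad n i < s <= dyad n i.+1.
Proof.
move=> s0; have p0 : 0 < 2 ^+ n :> R by rewrite exprn_gt0.
have ex : exists k : nat, s <= dyad n k.
  exists (Num.truncn (s * 2 ^+ n)).+1; rewrite /dyad ler_pdivlMr//.
  by apply: ltW; exact: truncnS_gt.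
case: (ex_minnP ex) => -[|i] hi hm; first by move: hi; rewrite dyad0 leNgt s0.
by exists i; rewrite hi andbT ltNge; apply/negP => /hm; rewrite ltnn.
Qed.

Lemma dyad_index_lt n i s : dyad n i < s -> s <= 1 -> (i < 2 ^ n)%N.
Proof. by move=> is1 s1; rewrite -(dyad_lt n) dyad1 (lt_le_trans is1). Qed.

Lemma cvg_half : (2 ^+ n)^-1 @[n --> \oo] --> (0 : R).
Proof.
have h : 2^-1 ^+ n @[n --> \oo] --> (0 : R).
  by apply: cvg_expr; rewrite ger0_norm//; lra.
by rewrite (_ : (fun n => _) = fun n => 2^-1 ^+ n)//; apply/funext => n; rewrite exprVn.
Qed.

Lemma dyad_cvgl (s : R) (i : nat -> nat) :
  (forall n, dyad n (i n) <= s <= dyad n (i n).+1) -> dyad n (i n) @[n --> \oo] --> s.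
Proof.
move=> h; apply: (squeeze_cvgr (f := fun n => s - (2 ^+ n)^-1) (h := fun _ => s)).
- apply: nearW => n; have /andP[h1 h2] := h n; rewrite h1 andbT.
  by rewrite lerBlDr -(dyad_step n (i n)) addrC subrK.
- by rewrite -[X in _ --> X]subr0; apply: cvgB; [exact: cvg_cst|exact: cvg_half].
- exact: cvg_cst.
Qed.

Lemma dyad_cvgr (s : R) (i : nat -> nat) :
  (forall n, dyad n (i n) <= s <= dyad n (i n).+1) -> dyad n (i n).+1 @[n --> \oo] --> s.
Proof.
move=> h; apply: (squeeze_cvgr (f := fun _ => s) (h := fun n => s + (2 ^+ n)^-1)).
- apply: nearW => n; have /andP[h1 h2] := h n; rewrite h2 /=.
  by rewrite -(dyad_step n (i n)) addrCA lerDl subr_ge0.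
- exact: cvg_cst.
- by rewrite -[X in _ --> X]addr0; apply: cvgD; [exact: cvg_cst|exact: cvg_half].
Qed.

End dyadics.

(** * Paths closed by their left limit at 1, and first passage times *)

Section closed_path.
Context {R : realType}.
Variable g : G0 R.
Local Notation f := (sval g).

(* The jump of g at 1 is not in J_g, while g(1) = 1 by convention; with the left limit
   at 1 the sums over the grid converge for every g, not only almost surely. *)
Definition gbar (t : R) : R := if t == 1 then lft f 1 else f t.

Lemma gbar_lt1 t : t < 1 -> gbar t = f t.
Proof. by move=> t1; rewrite /gbar lt_eqF. Qed.

Lemma gbar1 : gbar 1 = lft f 1. Proof. by rewrite /gbar eqxx. Qed.

Lemma gbar_itv t : 0 <= gbar t <= 1.
Proof. by rewrite /gbar; case: ifP => _; [exact: lft_itv|exact: G0_itv]. Qed.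

Lemma gbar_le s t : s <= t -> t <= 1 -> gbar s <= gbar t.
Proof.
move=> st; rewrite le_eqVlt => /predU1P[t1|t1]; last first.
  by rewrite !gbar_lt1 ?(le_lt_trans st)//; exact: G0_nondecreasing.
move: st; rewrite t1 le_eqVlt => /predU1P[->//|s1].
by rewrite gbar1 gbar_lt1//; exact: lft_ge.
Qed.

Lemma gbar_le_lft s t : s < t -> t <= 1 -> gbar s <= lft f t.
Proof. by move=> st t1; rewrite gbar_lt1 ?(lt_le_trans st)//; exact: lft_ge. Qed.

Lemma lft_le_gbar t : lft f t <= gbar t.
Proof. by rewrite /gbar; case: eqP => [->//|_]; exact: lft_le. Qed.

Lemma gbar_cvgl (p : R) (q : nat -> R) : p <= 1 -> (forall n, q n < p) ->
  q n @[n --> \oo] --> p -> gbar (q n) @[n --> \oo] --> lft f p.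
Proof.
move=> p1 qp qc; under eq_fun do rewrite gbar_lt1 ?(lt_le_trans (qp _))//.
exact: lft_cvg_seq.
Qed.

Lemma gbar_cvgr (p : R) (q : nat -> R) : (forall n, p <= q n <= 1) ->
  q n @[n --> \oo] --> p -> gbar (q n) @[n --> \oo] --> gbar p.
Proof.
move=> pq qc; have : p <= 1 by have /andP[/le_trans] := pq 0%N; exact.
rewrite le_eqVlt => /predU1P[p1|p1].
  rewrite (_ : (fun _ => _) = cst (gbar p)); first exact: cvg_cst.
  apply/funext => n; congr gbar; apply/eqP; rewrite eq_le.
  by have /andP[-> q1] := pq n; rewrite p1 q1.
rewrite (gbar_lt1 p1).
apply: cvg_trans (right_cvg_seq _ qc); last by move=> n; case/andP: (pq n).
apply: near_eq_cvg; near=> n; rewrite gbar_lt1//.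
by near: n; move/cvgr_lt : qc; apply.
Unshelve. all: by end_near. Qed.

(** First passage time: [a] is the infimum of the times at which the path has reached [u]. Right
    continuity gives u <= gbar a, and gbar 0 < u gives a > 0. *)
Lemma level_time u : gbar 0 < u -> u <= gbar 1 ->
  exists a, [/\ 0 < a, a <= 1, u <= gbar a & forall t, 0 <= t -> t < a -> gbar t < u].
Proof.
move=> u0 u1; pose E := [set t : R | 0 <= t <= 1 /\ u <= gbar t].
have E1 : E 1 by rewrite /E/= ler01 lexx.
have lbE : lbound E 0 by move=> t [/andP[]].
have hiE : has_inf E by split; [exists 1|exists 0].
have a0 : 0 <= inf E by apply: lb_le_inf => //; exists 1.
have a1 : inf E <= 1 by apply: ge_inf => //; exists 0.
have below t : 0 <= t -> t < inf E -> gbar t < u.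
  move=> t0 ta; rewrite ltNge; apply/negP => ut.
  have : inf E <= t.
    apply: ge_inf; first by exists 0.
    by rewrite /E/= t0 ut (le_trans (ltW ta)).
  by rewrite leNgt ta.
have ua : u <= gbar (inf E).
  rewrite leNgt; apply/negP => au.
  (* At time 1 the level is reached by hypothesis; before 1 [gbar] is [g], so right continuity
     applies. *)
  have a1' : inf E < 1.
    by rewrite lt_neqAle a1 andbT; apply: contraTneq u1 => <-; rewrite -ltNge.
  move: (au); rewrite gbar_lt1// => au'.
  have := @G0_right_cvg _ g (inf E) => /cvgr_lt /(_ _ au')[e /= e0 he].
  have d0 : 0 < Num.min e (1 - inf E) by rewrite lt_min e0 subr_gt0.
  have [x [/andP[x0 x1] ux] xd] := inf_adherent d0 hiE.
  have ax : inf E <= x by apply: ge_inf; [exists 0|rewrite /E/= x0].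
  have ax' : inf E < x.
    by rewrite lt_neqAle ax andbT; apply: contraTneq ux => <-; rewrite -ltNge.
  have [xe x1'] : x - inf E < e /\ x < 1.
    move: xd; rewrite -ltrBlDl lt_min => /andP[-> ]; rewrite ltrD2r// => ->.
  have : f x < u.
    by apply: he => //=; rewrite distrC gtr0_norm// subr_gt0.
  by rewrite -(gbar_lt1 x1') ltNge ux.
exists (inf E); split => //; rewrite lt_neqAle a0 andbT.
by apply: contraTneq u0 => ->; rewrite -leNgt.
Qed.

End closed_path.

(** * The sum over the jumps *)

Section jump_sum.
Context {R : realType}.
Variable h : R -> R.
Hypothesis C2h : C2_isomorphism h.
Variable g : G0 R.
Local Notation mu := (@lebesgue_measure R).
Local Notation f := (sval g).
Local Notation gb := (gbar g).
Local Notation dh := (derive1 h).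
Implicit Types (u : R).

Definition grid n i : R := gb (dyad n i).

Lemma grid_le n i k : (i <= k <= 2 ^ n)%N -> grid n i <= grid n k.
Proof.
move=> /andP[ik kN]; apply: gbar_le; first by rewrite dyad_le.
by have /andP[] := @dyad_itv R _ _ kN.
Qed.

Lemma grid_itv n i : 0 <= grid n i <= 1. Proof. exact: gbar_itv. Qed.

Lemma grid0 n : grid n 0 = gb 0. Proof. by rewrite /grid dyad0. Qed.

Lemma gridN n : grid n (2 ^ n) = gb 1. Proof. by rewrite /grid dyad1. Qed.

(* Spreading each term of the sum over ]x_i, x_{i+1}] turns the sum over the grid into
   an integral over the values u of g.  For fixed u only the interval in which g passes
   the level u counts: it shrinks to a jump of g, or to a point, where jratio tends to 0. *)
Definition psi n u : R := \sum_(i < 2 ^ n)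
  ocind (grid n i) (grid n i.+1) u * jratio h (grid n i) (grid n i.+1).

Lemma jumpsP a : jumps f a -> 0 < a < 1 /\ lft f a < f a.
Proof.
move=> [a01]; rewrite rgtE => lr; split => //.
by rewrite lt_neqAle lr lft_le.
Qed.

(** Before [a] the path stays at or below g(a-) < u, and at [a] it reaches [u]: a jump time is the
    first passage time of each level that the jump crosses. *)
Lemma jump_level a u t : jumps f a -> lft f a < u <= f a ->
  0 <= t <= 1 -> u <= gb t -> (forall s, 0 <= s -> s < t -> gb s < u) -> t = a.
Proof.
move=> /jumpsP[/andP[a0 a1] lr] /andP[lu ur] /andP[t0 t1] ut hs.
apply/eqP; rewrite eq_le; apply/andP; split; rewrite leNgt; apply/negP.
  by move=> /(hs a (ltW a0)); rewrite gbar_lt1// ltNge ur.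
by move=> ta; have := lt_le_trans lu ut; rewrite ltNge gbar_le_lft// ltW.
Qed.

Lemma jump_levelP a u : jumps f a -> lft f a < u <= f a ->
  [/\ gb 0 < u, u <= gb 1, u <= gb a & forall s, 0 <= s -> s < a -> gb s < u].
Proof.
move=> /jumpsP[/andP[a0 a1] lr] /andP[lu ur]; split.
- by apply: le_lt_trans lu; apply: gbar_le_lft => //; exact: ltW.
- by apply: (le_trans ur); rewrite -(gbar_lt1 g a1) gbar_le// ltW.
- by rewrite gbar_lt1.
- by move=> s s0 sa; apply: le_lt_trans lu; apply: gbar_le_lft => //; exact: ltW.
Qed.

Lemma jumps_disjoint a b u : jumps f a -> jumps f b ->
  lft f a < u <= f a -> lft f b < u <= f b -> a = b.
Proof.
move=> ja jb ua ub; have [_ _ uga hs] := jump_levelP ja ua.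
apply: (jump_level jb ub _ uga hs).
by have [/andP[a0 a1] _] := jumpsP ja; rewrite !ltW.
Qed.

(** The ranges of distinct jumps are disjoint in [0,1], so their lengths sum to at most 1, which
    leaves room for at most 1/e jumps of size at least [e]. *)
Lemma finite_jumps_ge (e : R) : 0 < e -> finite_set (jumps_ge f e).
Proof.
move=> e0; apply: contrapT => inf.
have [B BJ hB] := @infinite_set_fset _ _ (Num.truncn (e^-1)).+1 inf.
have BJ' b : b \in enum_fset B -> jumps f b /\ e <= f b - lft f b.
  by move=> bB; have := BJ b bB; rewrite /jumps_ge/= rgtE.
have : \sum_(b <- enum_fset B) (f b - lft f b) * 1 <= 1.
  rewrite -(@Rintegral_step _ _ _ (fun b => lft f b) (fun b => f b) (fun _ => 1)); last first.
    move=> b /BJ'[/jumpsP[_ /ltW ->] _].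
    by have /andP[-> _] := lft_itv g b; have /andP[_ ->] := G0_itv g b.
  have le1 u : \sum_(b <- enum_fset B) ocind (lft f b) (f b) u * 1 <= 1.
    have [[b [bB ub]]|nb] := pselect (exists b, b \in enum_fset B /\ lft f b < u <= f b).
      rewrite (sum_at_most_one (j := b))//.
        by rewrite ocindE ub mulr1.
      move=> c cB; rewrite ocindE mulr1; case: (boolP (lft f c < u <= f c)) => [uc|//].
      move/eqP => cb; exfalso; apply: cb.
      by apply: (@jumps_disjoint c b u); [case: (BJ' c cB)|case: (BJ' b bB)|..].
    rewrite big_seq big1// => b bB; rewrite ocindE.
    by case: (boolP (lft f b < u <= f b)) => [ub|]; [exfalso; apply: nb; exists b|rewrite mul0r].
  have ge0 u : 0 <= \sum_(b <- enum_fset B) ocind (lft f b) (f b) u * 1.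
    by apply: sumr_ge0 => b _; rewrite ocindE mulr1.
  have mS : measurable_fun setT (fun u => \sum_(b <- enum_fset B) ocind (lft f b) (f b) u * 1).
    by apply: measurable_sum => b; apply: measurable_funM => //; exact: measurable_ocind.
  apply: (@le_trans _ _ (Rintegral mu `[0, 1] (fun _ => 1))).
    apply: le_Rintegral => //.
    - by apply: (integrable_bounded01 mS (K := 1)) => u; rewrite ger0_norm.
    - by apply: (integrable_bounded01 (K := 1)) => // u; rewrite normr1.
  by rewrite Rintegral_cst// lebesgue_itv/= lte_fin ltr01/= subr0 mulr1.
apply/negP; rewrite -ltNge.
apply: (@lt_le_trans _ _ (\sum_(b <- enum_fset B) e)).
  rewrite big_const_seq count_predT iter_addr_0 -mulr_natr mulrC.
  rewrite -ltr_pdivrMr// mul1r; apply: (lt_le_trans (truncnS_gt _)).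
  by rewrite ler_nat.
by rewrite big_seq [leRHS]big_seq; apply: ler_sum => b /BJ'[_]; rewrite mulr1.
Qed.

(** Counterpart of [psi] for the jumps: each term is spread over the levels that the jump
    crosses. *)
Definition phi k u : R := \sum_(b <- fset_set (jumps_ge f k.+1%:R^-1))
  ocind (lft f b) (f b) u * jratio h (lft f b) (f b).

Lemma mem_jumps_ge k b : (b \in (fset_set (jumps_ge f k.+1%:R^-1) : seq R)) <->
  jumps f b /\ k.+1%:R^-1 <= f b - lft f b.
Proof.
rewrite in_fset_set; last by apply: finite_jumps_ge; rewrite invr_gt0.
by rewrite inE /jumps_ge/= rgtE.
Qed.

(** Level [u] is passed on the dyadic interval around its first passage time [a]; the values at its
    ends tend to g(a-) and to [gbar g a], and [jratio] is continuous along such pairs. *)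
Lemma psi_cvg u a : 0 < a -> a <= 1 -> u <= gb a ->
  (forall s, 0 <= s -> s < a -> gb s < u) ->
  psi n u @[n --> \oo] --> jratio h (lft f a) (gb a).
Proof.
move=> a0 a1 ua hs.
have [i hi] := choice (fun n => @dyad_index R n a a0).
have iN n : (i n < 2 ^ n)%N by have /andP[ia _] := hi n; exact: dyad_index_lt ia a1.
have i0 n : 0 <= dyad n (i n) :> R by have /andP[] := @dyad_itv R _ _ (ltnW (iN n)).
have i1 n : dyad n (i n).+1 <= 1 :> R by have /andP[] := @dyad_itv R _ _ (iN n).
have gu n : grid n (i n) < u by have /andP[ia _] := hi n; exact: hs.
have ug n : u <= grid n (i n).+1.
  by have /andP[_ ai] := hi n; apply: (le_trans ua); exact: gbar_le.
have -> : psi ^~ u = fun n => jratio h (grid n (i n)) (grid n (i n).+1).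
  apply/funext => n; apply: (@step_value _ (2 ^ n) (grid n)
    (fun i => jratio h (grid n i) (grid n i.+1)) (i n) u (@grid_le n) (iN n)).
  by rewrite gu ug.
have hi' n : dyad n (i n) <= a <= dyad n (i n).+1.
  by have /andP[/ltW -> ->] := hi n.
apply: (jratio_cvg C2h).
- by move=> n; case/andP: (grid_itv n (i n)).
- by move=> n; exact: lt_le_trans (gu n) (ug n).
- by move=> n; case/andP: (grid_itv n (i n).+1).
- by case/andP: (lft_itv g a).
- exact: lft_le_gbar.
- by case/andP: (gbar_itv g a).
- apply: gbar_cvgl => //; first by move=> n; case/andP: (hi n).
  exact: dyad_cvgl.
- apply: gbar_cvgr; first by move=> n; case/andP: (hi' n) => _ ->; rewrite i1.
  exact: dyad_cvgr.
Qed.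

(** If [a] is a jump, its term is present from some [k] on and is the only one at this level;
    otherwise g(a-) = gbar g a and both sides are 0. Lower ends of jumps are excluded, as the
    half-open interval misses them. *)
Lemma phi_cvg u a : 0 < a -> a <= 1 -> u <= gb a ->
  (forall s, 0 <= s -> s < a -> gb s < u) -> ~ (lft f @` jumps f) u ->
  phi k u @[k --> \oo] --> jratio h (lft f a) (gb a).
Proof.
move=> a0 a1 ua hs nu.
have a01 : 0 <= a <= 1 by rewrite ltW.
have lu : lft f a <= u.
  apply: limr_le; first exact: lft_cvg.
  near=> s; have sa : s < a by near: s; exact: nbhs_left_lt.
  rewrite -gbar_lt1 ?(lt_le_trans sa)//; apply/ltW/hs => //.
  by near: s; exact: nbhs_left_ge.
have phi0 k : (forall b, jumps f b -> b != a) -> phi k u = 0.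
  move=> ha; rewrite /phi big_seq big1// => b /mem_jumps_ge[jb _].
  rewrite ocindE; case: (boolP (lft f b < u <= f b)) => [ub|]; last by rewrite mul0r.
  by have := ha b jb; rewrite -(jump_level jb ub a01 ua hs) eqxx.
have [ja|nja] := pselect (jumps f a); last first.
  have -> : jratio h (lft f a) (gb a) = 0.
    rewrite /jratio; suff -> : lft f a = gb a by rewrite ltxx.
    move: a1; rewrite le_eqVlt => /predU1P[->|a1]; first by rewrite gbar1.
    rewrite gbar_lt1//; apply/eqP; apply: contrapT => /negP lr; apply: nja.
    by split; [rewrite a0 a1|rewrite rgtE].
  apply: cvg_near_cst; apply: nearW => k; apply: phi0 => b jb.
  by apply/eqP => ba; apply: nja; rewrite -ba.
have [/andP[_ a1'] lr] := jumpsP ja.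
have uI : lft f a < u <= f a.
  rewrite -[X in _ <= X](gbar_lt1 g a1') ua andbT lt_neqAle lu andbT.
  by apply/eqP => e; apply: nu; exists a.
rewrite (gbar_lt1 g a1').
have [k0 hk0] : exists k0 : nat, k0.+1%:R^-1 <= f a - lft f a.
  exists (Num.truncn (f a - lft f a)^-1).
  rewrite -[leRHS]invrK lef_pV2 ?posrE ?invr_gt0 ?subr_gt0//.
  by apply: ltW; exact: truncnS_gt.
apply: cvg_near_cst; near=> k.
rewrite /phi (sum_at_most_one (j := a))//.
- by rewrite ocindE uI mul1r.
- exact: fset_uniq.
- apply/mem_jumps_ge; split => //; apply: le_trans hk0.
  rewrite lef_pV2 ?posrE// ler_nat ltnS; near: k; exact: nbhs_infty_ge.
- move=> b /mem_jumps_ge[jb _] ba; rewrite ocindE.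
  case: (boolP (lft f b < u <= f b)) => [ub|]; last by rewrite mul0r.
  by move: ba; rewrite (jumps_disjoint jb ja ub uI) eqxx.
Unshelve. all: by end_near. Qed.

Lemma psi_out u : ~~ (gb 0 < u <= gb 1) -> forall n, psi n u = 0.
Proof.
move=> hu n; apply: (@step_value0 _ (2 ^ n) (grid n)
    (fun i => jratio h (grid n i) (grid n i.+1)) u (@grid_le n)).
by move: hu; rewrite negb_and -leNgt -ltNge grid0 gridN.
Qed.

Lemma phi_out u : ~~ (gb 0 < u <= gb 1) -> forall k, phi k u = 0.
Proof.
move=> hu k; rewrite /phi big_seq big1// => b /mem_jumps_ge[jb _].
rewrite ocindE; case: (boolP (lft f b < u <= f b)) => [ub|]; last by rewrite mul0r.
have [g0 g1 _ _] := jump_levelP jb ub.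
by move: hu; rewrite g0 g1.
Qed.

Lemma jratio_bound : exists2 K : R, 0 < K & forall x y, 0 <= x -> y <= 1 -> `|jratio h x y| <= K.
Proof.
have [m [B [K [m0 B0 K0 _ hK]]]] := jterm_bounds C2h; exists K => // x y x0 y1.
rewrite /jratio; case: ifPn => xy; last by rewrite normr0 ltW.
have yx : 0 < y - x by rewrite subr_gt0.
by rewrite normrM normfV (gtr0_norm yx) ler_pdivrMr// hK// ltW.
Qed.

(** Grid sums and jump sums are compared level by level: both tend to [jratio] at the first passage
    time. *)
Lemma psi_phi_lim : exists F : R -> R,
  (forall u, psi n u @[n --> \oo] --> F u) /\
  (forall u, ~ (lft f @` jumps f) u -> phi k u @[k --> \oo] --> F u).
Proof.
have H u : exists l : R, psi n u @[n --> \oo] --> l /\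
    (~ (lft f @` jumps f) u -> phi k u @[k --> \oo] --> l).
  have [/andP[u0 u1]|hu] := boolP (gb 0 < u <= gb 1); last first.
    exists 0; split => [|_].
      by under eq_fun do rewrite (psi_out hu); exact: cvg_cst.
    by under eq_fun do rewrite (phi_out hu); exact: cvg_cst.
  have [a [a0 a1 ua hs]] := level_time u0 u1.
  by exists (jratio h (lft f a) (gb a)); split; [exact: psi_cvg|exact: phi_cvg].
have [F hF] := choice H; exists F; split=> u; first by case: (hF u).
by case: (hF u).
Qed.

Lemma measurable_psi n : measurable_fun setT (psi n).
Proof.
by apply: measurable_sum => i; apply: measurable_funM => //; exact: measurable_ocind.
Qed.

Lemma measurable_phi k : measurable_fun setT (phi k).
Proof.
by apply: measurable_sum => i; apply: measurable_funM => //; exact: measurable_ocind.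
Qed.

Lemma Rintegral_psi n : Rintegral mu `[0, 1] (psi n) =
  \sum_(i < 2 ^ n) jterm h dh (grid n i) (grid n i.+1).
Proof.
rewrite /psi (Rintegral_step (x := fun i : 'I_(2 ^ n) => grid n i)
  (y := fun i : 'I_(2 ^ n) => grid n i.+1)
  (fun i : 'I_(2 ^ n) => jratio h (grid n i) (grid n i.+1))).
  apply: eq_bigr => i _; rewrite mulrC jratioE//; apply: grid_le.
  by rewrite leqnSn ltn_ord.
move=> i _; split; first by case/andP: (grid_itv n i).
  by apply: grid_le; rewrite leqnSn ltn_ord.
by case/andP: (grid_itv n i.+1).
Qed.

Lemma Rintegral_phi k : Rintegral mu `[0, 1] (phi k) =
  \sum_(b <- fset_set (jumps_ge f k.+1%:R^-1)) jterm h dh (lft f b) (f b).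
Proof.
rewrite /phi (Rintegral_step (x := lft f) (y := f) (fun b => jratio h (lft f b) (f b))).
  by apply: eq_bigr => b _; rewrite mulrC jratioE// lft_le.
move=> b _; split; [by case/andP: (lft_itv g b)|exact: lft_le|].
by case/andP: (G0_itv g b).
Qed.

Lemma countable_jumps : countable (jumps f).
Proof.
rewrite (_ : jumps f = \bigcup_k jumps_ge f k.+1%:R^-1).
  apply: bigcup_countable; first exact: countableP.
  by move=> k _; apply: finite_set_countable; apply: finite_jumps_ge; rewrite invr_gt0.
apply/seteqP; split=> [a ja|a [k _ []//]].
have [_ lr] := jumpsP ja.
exists (Num.truncn (f a - lft f a)^-1) => //; split => //.
rewrite rgtE -[leRHS]invrK lef_pV2 ?posrE ?invr_gt0 ?subr_gt0//.
by apply: ltW; exact: truncnS_gt.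
Qed.

Lemma sum_over_grid n (F : nat -> nat -> R) (D : R) :
  (forall i, (i < 2 ^ n)%N -> F n i <= D * (grid n i.+1 - grid n i)) -> 0 <= D ->
  \sum_(i < 2 ^ n) F n i <= D.
Proof.
move=> hF D0; apply: (@le_trans _ _ (\sum_(i < 2 ^ n) D * (grid n i.+1 - grid n i))).
  by apply: ler_sum => i _; exact: hF.
rewrite -mulr_sumr -(big_mkord xpredT (fun i => grid n i.+1 - grid n i)) telescope_sumr//.
rewrite ler_piMr// grid0 gridN.
have /andP[a0 _] := gbar_itv g 0; have /andP[_ b1] := gbar_itv g 1.
by rewrite lerBlDr (le_trans b1)// lerDl.
Qed.

(** At each level at most one term of either sum is nonzero, and [jratio] is bounded. *)
Lemma psi_bounded : exists K : R, (forall n u, `|psi n u| <= K) /\ (forall k u, `|phi k u| <= K).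
Proof.
have [K K0 hK] := jratio_bound; exists K; split=> [n u|k u].
  have [/andP[u0 u1]|hu] := boolP (gb 0 < u <= gb 1); last by rewrite psi_out// normr0 ltW.
  have [a [a0 a1 ua hs]] := level_time u0 u1.
  have [i /andP[ia ai]] := @dyad_index R n a a0.
  have iN : (i < 2 ^ n)%N := dyad_index_lt ia a1.
  rewrite /psi (@step_value _ (2 ^ n) (grid n)
    (fun i => jratio h (grid n i) (grid n i.+1)) i u (@grid_le n) iN).
    by apply: hK; [case/andP: (grid_itv n i)|case/andP: (grid_itv n i.+1)].
  rewrite hs//=; last by rewrite -(dyad0 n) dyad_le.
  apply: (le_trans ua); apply: gbar_le => //.
  by have /andP[] := @dyad_itv R _ _ iN.
have [[b [jb ub]]|nb] := pselect (exists b, b \in (fset_set (jumps_ge f k.+1%:R^-1) : seq R)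
    /\ lft f b < u <= f b).
  rewrite /phi (sum_at_most_one (j := b))//.
    rewrite ocindE ub mul1r; apply: hK; [by case/andP: (lft_itv g b)|by case/andP: (G0_itv g b)].
    exact: fset_uniq.
  move=> c /mem_jumps_ge[jc _] cb; rewrite ocindE.
  case: (boolP (lft f c < u <= f c)) => [uc|]; last by rewrite mul0r.
  move: jb => /mem_jumps_ge[jb _].
  by move: cb; rewrite (jumps_disjoint jc jb uc ub) eqxx.
rewrite /phi big_seq big1 ?normr0 ?ltW// => b jb; rewrite ocindE.
by case: (boolP (lft f b < u <= f b)) => [ub|]; [exfalso; apply: nb; exists b|rewrite mul0r].
Qed.

(** Both sequences are integrals over the levels of bounded functions with the common limit [F]. *)
Lemma jump_sum_cvg : exists l : R,
  (\sum_(i < 2 ^ n) jterm h dh (grid n i) (grid n i.+1) @[n --> \oo] --> l) /\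
  (\sum_(b <- fset_set (jumps_ge f k.+1%:R^-1)) jterm h dh (lft f b) (f b) @[k --> \oo] --> l).
Proof.
have [F [psiF phiF]] := psi_phi_lim.
have [K [hpsi hphi]] := psi_bounded.
have mF : measurable_fun setT F.
  by apply: (measurable_fun_cvg (h := psi)) => [n|u _]; [exact: measurable_psi|exact: psiF].
exists (Rintegral mu `[0, 1] F); split.
  under eq_fun do rewrite -Rintegral_psi.
  apply: (bounded_cvg_Rintegral measurable_psi mF hpsi (N0 := set0)) => //.
under eq_fun do rewrite -Rintegral_phi.
apply: (bounded_cvg_Rintegral measurable_phi mF hphi (N0 := lft f @` jumps f));
  last by move=> u _; exact: phiF.
exact: sub_countable (card_image_le _ _) countable_jumps.
Qed.

(** Exponentiating [jterm] at a jump gives [jfactor], so the partial products of [Y0] are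
    exponentials of the partial jump sums. *)
Lemma Y0_cvg : exists l : R,
  (\sum_(i < 2 ^ n) jterm h dh (grid n i) (grid n i.+1) @[n --> \oo] --> l) /\
  Y0 h f = expR l.
Proof.
have [l [c1 c2]] := jump_sum_cvg; exists l; split => //.
rewrite /Y0; apply: cvg_lim => //.
have [m m0 hm] := C2_isomorphism_lower C2h.
have [hinv [dif _ _]] := C2_isomorphism_diffeo01 C2h.
have e k : \big[*%R/1]_(a \in jumps_ge f k.+1%:R^-1) jfactor h f a =
    expR (\sum_(b <- fset_set (jumps_ge f k.+1%:R^-1)) jterm h dh (lft f b) (f b)).
  rewrite fsbig_finite; last by apply: finite_jumps_ge; rewrite invr_gt0.
  rewrite expR_sum big_seq [RHS]big_seq; apply: eq_bigr => b /mem_jumps_ge[/jumpsP[_ lr] _].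
  have l01 := lft_itv g b; have f01 := G0_itv g b.
  have dl := lt_le_trans m0 (hm _ l01); have df := lt_le_trans m0 (hm _ f01).
  have s0 := slope_gt0 dif l01 f01.
  rewrite /jfactor rgtE /jterm expRB lnK ?posrE//.
  rewrite [slope h dh _ _](_ : _ = (h (f b) - h (lft f b)) / (f b - lft f b)); last first.
    by rewrite /slope lr.
  congr (_ / _).
  rewrite -lnM ?posrE//.
  have p0 : 0 < derive1 h (lft f b) * derive1 h (f b) by exact: mulr_gt0.
  apply/eqP; rewrite -(eqrXn2 (n := 2)) ?sqrtr_ge0 ?expR_ge0//.
  by rewrite sqr_sqrtr ?ltW// expr2 -expRD -splitr lnK ?posrE.
rewrite (funext e); apply: (cvg_comp _ _ c2); exact: continuous_expR.
Qed.

End jump_sum.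

(** * The limiting density *)

Section limit_density.
Context {R : realType}.
Variable h : R -> R.
Hypothesis C2h : C2_isomorphism h.
Local Notation mu := (@lebesgue_measure R).
Local Notation dh := (derive1 h).
Implicit Types (g : G0 R).

Lemma ln_slope_bound : exists2 L : R, 0 <= L & forall x y, 0 <= x -> x <= y -> y <= 1 ->
  `|ln (slope h dh x y)| <= L.
Proof.
have [m [B [K [m0 B0 _ hB _]]]] := jterm_bounds C2h.
exists (`|ln m| + `|ln B|) => [|x y x0 xy y1]; first exact: addr_ge0.
have [c /andP[xc cy] ->] := C2_slope_MVT C2h x0 xy y1.
have c01 : 0 <= c <= 1 by rewrite (le_trans x0)// (le_trans cy).
have [/andP[mc cB] _] := hB c c01.
have c0 := lt_le_trans m0 mc.
have l1 : ln m <= ln (dh c) by rewrite ler_ln ?posrE.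
have l2 : ln (dh c) <= ln B by rewrite ler_ln ?posrE.
rewrite ler_norml; apply/andP; split.
  by rewrite opprD lerBlDr (le_trans _ (lerD l1 (normr_ge0 _)))// addr0 lerNl ler_normr lexx orbT.
by rewrite (le_trans l2)// (le_trans (ler_norm _))// lerDr.
Qed.

Section path.
Variable g : G0 R.
Local Notation f := (sval g).

Definition time_step n (s : R) : R := \sum_(i < 2 ^ n)
  ocind (dyad n i) (dyad n i.+1) s * ln (slope h dh (grid g n i) (grid g n i.+1)).

Lemma dyad_mono n i k : (i <= k <= 2 ^ n)%N -> dyad n i <= dyad n k :> R.
Proof. by rewrite dyad_le => /andP[]. Qed.

Lemma time_step_index n s i : (i < 2 ^ n)%N -> dyad n i < s <= dyad n i.+1 ->
  time_step n s = ln (slope h dh (grid g n i) (grid g n i.+1)).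
Proof.
exact: (@step_value _ (2 ^ n) (dyad n)
  (fun i => ln (slope h dh (grid g n i) (grid g n i.+1))) i s (@dyad_mono n)).
Qed.

(** At a continuity point the slope is h'(c) with [c] squeezed between two grid values tending to
    g(s). Time 0 lies in no half-open dyadic interval, and at 1 the grid uses g(1-) instead of
    g(1). *)
Lemma time_step_cvg s : 0 <= s <= 1 -> ~ (jumps f `|` [set 0; 1]) s ->
  time_step n s @[n --> \oo] --> ln (dh (f s)).
Proof.
move=> /andP[s0 s1] /not_orP[nj /not_orP[/eqP n0 /eqP n1]].
have {}s0 : 0 < s by rewrite lt_neqAle eq_sym n0 s0.
have {}s1 : s < 1 by rewrite lt_neqAle n1 s1.
have fl : lft f s = f s.
  apply/eqP; apply: contrapT => /negP lr; apply: nj.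
  by split; [rewrite s0 s1|rewrite rgtE].
have [i hi] := choice (fun n => @dyad_index R n s s0).
have iN n : (i n < 2 ^ n)%N by have /andP[ia _] := hi n; exact: dyad_index_lt ia (ltW s1).
have hi' n : dyad n (i n) <= s <= dyad n (i n).+1 by have /andP[/ltW -> ->] := hi n.
have gl : grid g n (i n) @[n --> \oo] --> f s.
  rewrite -fl; apply: gbar_cvgl => //; [exact: ltW| |exact: dyad_cvgl].
  by move=> n; case/andP: (hi n).
have gr : grid g n (i n).+1 @[n --> \oo] --> f s.
  rewrite -(gbar_lt1 g s1); apply: gbar_cvgr; last exact: dyad_cvgr.
  by move=> n; case/andP: (hi' n) => _ ->; case/andP: (@dyad_itv R _ _ (iN n)).
have H n : exists c : R, grid g n (i n) <= c <= grid g n (i n).+1 /\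
    slope h dh (grid g n (i n)) (grid g n (i n).+1) = dh c.
  have [|||c cc e] := @C2_slope_MVT R h C2h (grid g n (i n)) (grid g n (i n).+1).
  - by case/andP: (grid_itv g n (i n)).
  - by apply: grid_le; rewrite leqnSn iN.
  - by case/andP: (grid_itv g n (i n).+1).
  by exists c.
have [c hc] := choice H.
rewrite (_ : time_step ^~ s = fun n => ln (dh (c n))); last first.
  by apply/funext => n; rewrite (time_step_index (iN n))//; have [_ ->] := hc n.
have [m m0 hm] := C2_isomorphism_lower C2h.
have d0 : 0 < dh (f s) by apply: lt_le_trans m0 (hm _ (G0_itv g s)).
have cc : c n @[n --> \oo] --> f s.
  apply: (squeeze_cvgr _ gl gr); apply: nearW => n; by have [] := hc n.
have dcc : dh (c n) @[n --> \oo] --> dh (f s).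
  by apply: continuous_cvg => //; apply: C2_continuous1; exact: C2_isomorphism_C2.
by apply: (cvg_comp _ _ dcc); exact: continuous_ln.
Qed.

Lemma time_sum_cvg : \sum_(i < 2 ^ n) (dyad n i.+1 - dyad n i) *
    ln (slope h dh (grid g n i) (grid g n i.+1)) @[n --> \oo] -->
  Rintegral mu `[0, 1] (fun s => ln (dh (f s))).
Proof.
have [L L0 hL] := ln_slope_bound.
rewrite (_ : (fun n => _) = fun n => Rintegral mu `[0, 1] (time_step n)); last first.
  apply/funext => n; rewrite /time_step (Rintegral_step
    (x := fun i : 'I_(2 ^ n) => dyad n i) (y := fun i : 'I_(2 ^ n) => dyad n i.+1)
    (fun i : 'I_(2 ^ n) => ln (slope h dh (grid g n i) (grid g n i.+1))))//.
  move=> i _; split.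
  - by have /andP[] := @dyad_itv R _ _ (ltnW (ltn_ord i)).
  - by rewrite dyad_le.
  - by have /andP[] := @dyad_itv R _ _ (ltn_ord i).
have mf : measurable_fun setT f.
  by apply: nondecreasing_measurable => // s t; exact: G0_nondecreasing.
apply: (@bounded_cvg_Rintegral _ _ _ L (jumps f `|` [set 0; 1])).
- by move=> n; apply: measurable_sum => i; apply: measurable_funM => //; exact: measurable_ocind.
- apply: (measurableT_comp (@measurable_ln R)).
  have mdh : measurable_fun setT dh.
    by apply: continuous_measurable_fun; apply: C2_continuous1; exact: C2_isomorphism_C2.
  exact: (measurableT_comp mdh mf).
- move=> n s; have [/andP[s0 s1]|hs] := boolP (0 < s <= 1).
    have [i hi] := @dyad_index R n s s0.
    have iN : (i < 2 ^ n)%N by have /andP[ia _] := hi; exact: dyad_index_lt ia s1.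
    rewrite (time_step_index iN hi); apply: hL.
    + by case/andP: (grid_itv g n i).
    + by apply: grid_le; rewrite leqnSn iN.
    + by case/andP: (grid_itv g n i.+1).
  rewrite [time_step n s](_ : _ = 0) ?normr0//.
  apply: (@step_value0 _ (2 ^ n) (dyad n)
    (fun i => ln (slope h dh (grid g n i) (grid g n i.+1))) s (@dyad_mono n)).
  by move: hs; rewrite negb_and -leNgt -ltNge dyad0 dyad1.
- rewrite (_ : _ `|` _ = \bigcup_(k in [set: bool]) if k then jumps f else [set 0; 1]).
    apply: bigcup_countable => // -[] _; first exact: countable_jumps.
    exact: finite_set_countable.
  apply/seteqP; split=> [u [ju|e]|u [[] _ //]]; [by exists true|by exists false|by left|by right].
- exact: time_step_cvg.
Qed.

End path.

Variable beta : R.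
Hypothesis b0 : 0 < beta.

(** A dyadic grid of 2^n intervals has 2^n - 1 interior points, whence the predecessor. *)
Definition logdens_grid n g := logdens h dh beta (2 ^ n).-1 (dyad n) (grid g n).

Lemma logdens_gridE n g : logdens_grid n g =
  beta * \sum_(i < 2 ^ n) (dyad n i.+1 - dyad n i) *
    ln (slope h dh (grid g n i) (grid g n i.+1)) +
  \sum_(i < 2 ^ n) jterm h dh (grid g n i) (grid g n i.+1) -
  (ln (dh 0) + ln (dh 1)) / 2.
Proof.
rewrite /logdens_grid /logdens prednK ?expn_gt0//; congr (_ + _ - _).
by rewrite mulr_sumr; apply: eq_bigr => i _; rewrite mulrA.
Qed.

Lemma density_cvg g : expR (logdens_grid n g) @[n --> \oo] --> Yb0 beta h (sval g).
Proof.
have [l [cl Yl]] := Y0_cvg C2h g.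
have ct := @time_sum_cvg g.
have [m m0 hm] := C2_isomorphism_lower C2h.
have d0 : 0 < dh 0 by apply: lt_le_trans m0 (hm _ _); rewrite lexx ler01.
have d1 : 0 < dh 1 by apply: lt_le_trans m0 (hm _ _); rewrite lexx ler01.
have s0 : Num.sqrt (dh 0 * dh 1) = expR ((ln (dh 0) + ln (dh 1)) / 2).
  apply/eqP; rewrite -(eqrXn2 (n := 2)) ?sqrtr_ge0 ?expR_ge0//.
  rewrite sqr_sqrtr; last by rewrite mulr_ge0// ltW.
  by rewrite expr2 -expRD -splitr expRD !lnK ?posrE.
have -> : Yb0 beta h (sval g) = expR (beta *
    Rintegral mu `[0, 1] (fun s => ln (dh (sval g s))) + l - (ln (dh 0) + ln (dh 1)) / 2).
  by rewrite /Yb0 /Xb Yl s0 -expRN -!expRD; congr expR; ring.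
under eq_fun do rewrite logdens_gridE.
have c : beta * \sum_(i < 2 ^ n) (dyad n i.+1 - dyad n i) *
    ln (slope h dh (grid g n i) (grid g n i.+1)) +
  \sum_(i < 2 ^ n) jterm h dh (grid g n i) (grid g n i.+1) -
  (ln (dh 0) + ln (dh 1)) / 2 @[n --> \oo] -->
  beta * Rintegral mu `[0, 1] (fun s => ln (dh (sval g s))) + l -
  (ln (dh 0) + ln (dh 1)) / 2.
  apply: cvgB; last exact: cvg_cst.
  by apply: cvgD => //; apply: cvgM => //; exact: cvg_cst.
by apply: (cvg_comp _ _ c); exact: continuous_expR.
Qed.

(** Time steps sum to 1 and path increments to at most 1, which makes the bound uniform in [n] and
    [g]; it yields both the domination and the bounds on the limiting density. *)
Lemma logdens_grid_bounded : exists C : R, forall n g, `|logdens_grid n g| <= C.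
Proof.
have [L L0 hL] := ln_slope_bound.
have [m [B [K [m0 B0 K0 _ hK]]]] := jterm_bounds C2h.
exists (beta * L + K + `|(ln (dh 0) + ln (dh 1)) / 2|) => n g.
rewrite logdens_gridE (le_trans (ler_normB _ _))// lerD2r.
have gi i : (i < 2 ^ n)%N -> [/\ 0 <= grid g n i, grid g n i <= grid g n i.+1 & grid g n i.+1 <= 1].
  move=> iN; split; first by case/andP: (grid_itv g n i).
    by apply: grid_le; rewrite leqnSn iN.
  by case/andP: (grid_itv g n i.+1).
rewrite (le_trans (ler_normD _ _))// lerD//.
  rewrite normrM (gtr0_norm b0) ler_pM2l//.
  apply: (le_trans (ler_norm_sum _ _ _)).
  apply: (@le_trans _ _ (\sum_(i < 2 ^ n) (2 ^+ n)^-1 * L)).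
    apply: ler_sum => i _; rewrite dyad_step normrM ger0_norm ?invr_ge0 ?exprn_ge0//.
    rewrite ler_pM2l ?invr_gt0 ?exprn_gt0//.
    by have [? ? ?] := gi i (ltn_ord i); exact: hL.
  rewrite sumr_const card_ord -[leLHS]mulr_natr natrX mulrC mulrA mulfV ?mul1r//.
apply: (le_trans (ler_norm_sum _ _ _)).
have sg := @sum_over_grid R g n (fun n i => `|jterm h dh (grid g n i) (grid g n i.+1)|) K.
apply: sg.
  by move=> i iN; have [? ? ?] := gi i iN; exact: hK.
exact: ltW.
Qed.

Lemma measurable_logdens_grid n :
  measurable_fun setT (fun g : G0m R => expR (logdens_grid n g)).
Proof.
have [hinv [dif _ _]] := C2_isomorphism_diffeo01 C2h.
apply: (measurableT_comp (@measurable_expR R)).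
apply: (@measurable_logdens R h dh hinv dif _ (G0m R) beta _ _
  (fun i (g : G0m R) => grid g n i)) => i.
rewrite /grid /gbar; case: eqP => _; [exact: measurable_lft|exact: measurable_eval].
Qed.

Lemma measurable_Yb0 : measurable_fun setT (fun g : G0m R => Yb0 beta h (sval g)).
Proof.
apply: (measurable_fun_cvg (h := fun n (g : G0m R) => expR (logdens_grid n g))).
  exact: measurable_logdens_grid.
by move=> g _; exact: density_cvg.
Qed.

Lemma Yb0_bounds : exists c C : R, 0 < c /\
  forall g : G0m R, c <= Yb0 beta h (sval g) <= C.
Proof.
have [C hC] := logdens_grid_bounded.
exists (expR (- C)), (expR C); split; first exact: expR_gt0.
move=> g; have cv := @density_cvg g.
rewrite -(cvg_lim (@Rhausdorff R) cv).
have ic : cvgn (fun n => expR (logdens_grid n g)) by apply/cvg_ex; eexists; exact: cv.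
apply/andP; split; [apply: limr_ge => //|apply: limr_le => //]; apply: nearW => n;
  have := hC n g; rewrite ler_norml => /andP[? ?]; by rewrite ler_expR.
Qed.

End limit_density.

(** * Dyadic cylinders and the translation *)

Section dyadic_pi_system.
Context {R : realType}.

Definition dproj n (g : G0m R) : seqm R := proj (2 ^ n).-1 (dyad n) (sval g).

Lemma measurable_dproj n : measurable_fun setT (dproj n).
Proof. exact: measurable_proj. Qed.

Definition dyadic_sets : set (set (G0m R)) :=
  [set A | exists n (B : set (seqm R)), measurable B /\ A = dproj n @^-1` B].

(** As i / 2^n = (i 2^(k-n)) / 2^k, coarse coordinates are read off from the finer grid. *)
Lemma dproj_refine n k (B : set (seqm R)) : (n <= k)%N -> measurable B ->
  exists B' : set (seqm R), measurable B' /\ dproj n @^-1` B = dproj k @^-1` B'.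
Proof.
move=> nk mB.
pose r (x : seqm R) : seqm R := fun i =>
  if (1 <= i <= (2 ^ n).-1)%N then x (i * 2 ^ (k - n))%N else 0.
have mr : measurable_fun setT r.
  apply: measurable_to_seq => i; rewrite /r; case: (_ <= _ <= _)%N => //.
  exact: measurable_coord.
exists (r @^-1` B); split; first by rewrite -[X in measurable X]setTI; exact: mr.
suff -> : dproj n = r \o dproj k by [].
apply/funext => g; apply/funext => i; rewrite /= /r /dproj /proj.
case: (boolP (1 <= i <= (2 ^ n).-1)%N) => // /andP[i1 iN].
have p0 m : (0 < 2 ^ m)%N by rewrite expn_gt0.
have -> : (1 <= i * 2 ^ (k - n) <= (2 ^ k).-1)%N.
  rewrite muln_gt0 i1 p0/= -ltnS prednK//.
  rewrite -{2}(subnK nk) addnC expnD ltn_pmul2r//.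
  by rewrite -(prednK (p0 n)) ltnS.
congr (sval g _); rewrite /dyad natrM natrX.
have -> : (2 : R) ^+ k = 2 ^+ n * 2 ^+ (k - n) by rewrite -exprD subnKC.
have e0 : (2 : R) ^+ (k - n) != 0 by rewrite expf_neq0.
have e1 : (2 : R) ^+ n != 0 by rewrite expf_neq0.
by rewrite invfM mulrACA divff// mulr1.
Qed.

Lemma setI_closed_dyadic : setI_closed dyadic_sets.
Proof.
move=> _ _ [n [B [mB ->]]] [m [C [mC ->]]].
have [B' [mB' ->]] := dproj_refine (leq_maxl n m) mB.
have [C' [mC' ->]] := dproj_refine (leq_maxr n m) mC.
by exists (maxn n m), (B' `&` C'); split => //; exact: measurableI.
Qed.

(** By right continuity g(t) is a limit of values of g at dyadic times not smaller than t. *)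
Lemma measurable_dyadic : @measurable _ (G0m R) = <<s dyadic_sets >>.
Proof.
apply/seteqP; split; last first.
  apply: smallest_sub; first exact: sigma_algebra_measurable.
  by move=> _ [n [B [mB ->]]]; rewrite -[X in measurable X]setTI; exact: measurable_dproj.
apply: smallest_sub; first exact: smallest_sigma_algebra.
move=> _ [t [B [mB ->]]].
pose T := g_sigma_algebraType dyadic_sets.
suff me : measurable_fun [set: T] (fun g : T => sval g t).
  by have := me measurableT B mB; rewrite setTI.
have [t0|t0] := ltP t 0.
  rewrite (_ : (fun g : T => _) = cst 0)//; apply/funext => g.
  by have [_ _ _ fl _] := svalP g; rewrite fl.
have [t1|t1] := leP 1 t.
  rewrite (_ : (fun g : T => _) = cst 1)//; apply/funext => g.
  by have [_ _ _ _ fr] := svalP g; rewrite fr.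
have H n : exists i, dyad n i <= t <= dyad n i.+1.
  move: t0; rewrite le_eqVlt => /predU1P[<-|t0].
    by exists 0%N; rewrite dyad0 lexx -(dyad0 n) dyad_le.
  have [i /andP[i1 i2]] := @dyad_index R n t t0.
  by exists i; rewrite (ltW i1).
have [i hi] := choice H.
apply: (measurable_fun_cvg (h := fun n (g : T) => sval g (dyad n (i n).+1))); last first.
  move=> g _; apply: right_cvg_seq; first by move=> n; case/andP: (hi n).
  exact: dyad_cvgr.
(* A dyadic time at or beyond 1 is no interior coordinate, but g is constantly 1 there. *)
move=> n; have [iN|iN] := leqP (2 ^ n) (i n).+1.
  rewrite (_ : (fun g : T => _) = cst 1)//; apply/funext => g.
  have [_ _ _ _ fr] := svalP g; rewrite fr//.
  by rewrite -(dyad1 n) dyad_le.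
move=> _ C mC; rewrite setTI; apply: sub_sigma_algebra.
exists n, ((fun x : seqm R => x (i n).+1) @^-1` C); split.
  by rewrite -[X in measurable X]setTI; exact: measurable_coord.
have iN' : (1 <= (i n).+1 <= (2 ^ n).-1)%N by rewrite /= -ltnS prednK// expn_gt0.
by apply/seteqP; split=> g /=; rewrite /dproj /proj iN'.
Qed.

End dyadic_pi_system.

Section translation.
Context {R : realType}.
Variables (h hinv : R -> R).
Hypotheses (dif : diffeo01 h (derive1 h) hinv) (chinv : continuous hinv).
Hypothesis mono : {in `[0, 1] &, {homo hinv : x y / x <= y}}.

Lemma hinv0 : hinv 0 = 0.
Proof.
have [_ _ _ _ [h0 _ _ hK]] := dif.
by have [_] := hK 0 ltac:(by rewrite lexx ler01); rewrite h0.
Qed.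

Lemma hinv1 : hinv 1 = 1.
Proof.
have [_ _ _ _ [_ h1 _ hK]] := dif.
by have [_] := hK 1 ltac:(by rewrite lexx ler01); rewrite h1.
Qed.

Lemma translate_G0 (g : G0 R) : isG0 (hinv \o sval g).
Proof.
have [_ _ _ _ [_ _ hi _]] := dif; have [gm g01 gc gl gr] := svalP g.
split.
- move=> s t s01 t01 st /=; apply: mono; rewrite ?in_itv/= ?G0_itv//.
  exact: G0_nondecreasing.
- by move=> t t01 /=; have [] := hi _ (G0_itv g t).
- by move=> t t01; apply: (cvg_comp _ _ (gc t t01)); exact: chinv.
- by move=> t t0 /=; rewrite gl// hinv0.
- by move=> t t1 /=; rewrite gr// hinv1.
Qed.

Definition translate (g : G0m R) : G0m R := exist _ (hinv \o sval g) (translate_G0 g).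

Lemma measurable_translate : measurable_fun setT translate.
Proof.
have [_ _ mhi _ _] := dif.
apply: (@measurability _ _ (G0m R) (G0m R) setT translate (@G0_cylinders R)) => //.
move=> _ [_ [t [B [mB ->]]] <-]; rewrite setTI.
have := measurableT_comp mhi (@measurable_eval R t).
by move=> /(_ measurableT B mB); rewrite setTI.
Qed.

(** Since [h] and [hinv] are mutually inverse on [0,1], where paths take their values, the image is
    a preimage under a measurable map. *)
Lemma tau_imgE (A : set (G0m R)) : tau_img h A = translate @^-1` A.
Proof.
have [_ _ _ _ [_ _ hi hK]] := dif.
apply/seteqP; split=> g /=.
  move=> [g' Ag' e]; rewrite (_ : translate g = g')//.
  apply: eq_sig_hprop => [x p q|]; first exact: Prop_irrelevance.
  apply/funext => t /=.
  by rewrite e /=; have [] := hK _ (G0_itv g' t).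
move=> Ag; exists (translate g) => //; apply/funext => t /=.
by have [_ ->] := hi _ (G0_itv g t).
Qed.

End translation.

(** * Quasi-invariance *)

Section quasi_invariance.
Context {R : realType}.
Variables (beta : R) (h : R -> R) (Q : probability (G0m R) R).
Hypotheses (b0 : 0 < beta) (C2h : C2_isomorphism h) (dQ : dirichlet_marginals beta Q).
Local Notation dh := (derive1 h).

(** Junction of the two end conventions: almost surely g(0) = 0 and g(1-) = 1, so the boundary
    values in the Dirichlet density are those of the path. One null set serves all [n]. *)
Lemma bnd_dproj : {ae Q, forall g : G0m R, forall n i, (i <= (2 ^ n).-1.+1)%N ->
  bnd (2 ^ n).-1 (dproj n g) i = grid g n i}.
Proof.
have a0 := @G0_at0 R beta Q b0 dQ; have a1 := @G0_lft1 R beta Q b0 dQ.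
apply: filterS2 a0 a1 => g g0 g1 n i iN.
have p0 : (0 < 2 ^ n)%N by rewrite expn_gt0.
rewrite /bnd; case: eqVneq => [->|i0]; first by rewrite grid0 gbar_lt1.
case: eqVneq => [->|iN1]; first by rewrite prednK// gridN gbar1.
have iN2 : (1 <= i <= (2 ^ n).-1)%N.
  by rewrite lt0n i0/=; move: iN; rewrite leq_eqVlt (negbTE iN1) ltnS.
rewrite /dproj /proj iN2 /grid gbar_lt1//.
by rewrite -(dyad1 n) dyad_lt; case/andP: iN2 => _; rewrite -ltnS prednK.
Qed.

Variable hinv : R -> R.
Hypotheses (dif : diffeo01 h dh hinv) (chinv : continuous hinv).
Hypothesis mono : {in `[0, 1] &, {homo hinv : x y / x <= y}}.
Local Notation tr := (translate dif chinv mono).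

Lemma quasi_invariance_dyadic n (F : seqm R -> \bar R) : (0 < n)%N -> nnm F ->
  (\int[Q]_g F (dproj n (tr g)) =
   \int[Q]_g (F (dproj n g) * (expR (logdens_grid h beta n g))%:E))%E.
Proof.
move=> n0 nF; have p0 : (0 < 2 ^ n)%N by rewrite expn_gt0.
(* [dirichlet_marginals] speaks of grids with at least one interior point, hence n > 0. *)
have N0 : (0 < (2 ^ n).-1)%N by rewrite -ltnS prednK// -[1%N](expn0 2) ltn_exp2l.
have t1 : dyad n (2 ^ n).-1.+1 = 1 :> R by rewrite prednK// dyad1.
have tlt i : (i <= (2 ^ n).-1)%N -> dyad n i < dyad n i.+1 :> R by rewrite dyad_lt.
transitivity (\int[Q]_g F (coordwise hinv (2 ^ n).-1 (dproj n g)))%E.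
  apply: eq_integral => g _; congr F; apply/funext => i.
  by rewrite /coordwise /dproj /proj; case: (_ <= _ <= _)%N.
rewrite (dirichlet_quasi_invariant dif dQ N0 (dyad0 n) t1 tlt nF).
have nW d (T : measurableType d) (w : T -> R) : measurable_fun setT w ->
    nnm (fun g => (expR (w g))%:E).
  move=> mw; apply: nnm_EFin => [|g]; last exact: expR_ge0.
  exact: (measurableT_comp (@measurable_expR R)).
have nFd := nnm_comp (@measurable_dproj R n) nF.
have mb i : measurable_fun setT (fun g : G0m R => bnd (2 ^ n).-1 (dproj n g) i).
  exact: (measurableT_comp (measurable_bnd _ i) (@measurable_dproj R n)).
have nW1 := nW _ _ _ (@measurable_logdens R h dh hinv dif _ (G0m R) beta (2 ^ n).-1 (dyad n)
    (fun i g => bnd (2 ^ n).-1 (dproj n g) i) mb).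
have [m1 p1] := nnmM nFd nW1.
have m2 : measurable_fun setT (fun g : G0m R =>
    (F (dproj n g) * (expR (logdens_grid h beta n g))%:E)%E).
  apply: emeasurable_funM; first by case: nFd.
  by apply/measurable_EFinP; exact: measurable_logdens_grid.
apply: (@ae_eq_integral _ _ _ Q setT _ _ measurableT m1 m2).
have ab := bnd_dproj.
apply: filterS ab => g hg _; congr (_ * (expR _)%:E)%E.
by apply: eq_logdens => i iN; exact: hg.
Qed.

(** Dyadic cylinders determine both functionals. A cylinder of level n is also one of each level k >
    n, so the left side does not change with k while the densities on the right converge
    boundedly. *)
Lemma quasi_invariance_integral (F : G0m R -> \bar R) : nnm F ->
  (\int[Q]_g F (tr g) = \int[Q]_g (F g * (Yb0 beta h (sval g))%:E))%E.
Proof.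
move: F.
have mY := @measurable_Yb0 R h C2h beta.
have [c [C [c0 hC]]] := Yb0_bounds C2h b0.
have Y0 (g : G0m R) : 0 <= Yb0 beta h (sval g).
  by have /andP[h1 _] := hC g; exact: le_trans (ltW c0) h1.
have HI := integral_like_comp (integral_like_integral Q measurableT)
  (measurable_translate dif chinv mono).
have HJ := integral_like_weight (integral_like_integral Q measurableT) mY Y0.
have key A : dyadic_sets A -> (\int[Q]_g (EFin \o \1_A) (tr g) =
    \int[Q]_g ((EFin \o \1_A) g * (Yb0 beta h (sval g))%:E))%E.
  move=> [n [B [mB ->]]].
  set A' := dproj n @^-1` B.
  have mA : measurable A' by rewrite -[X in measurable X]setTI; exact: measurable_dproj.
  have const_seq k : (n < k)%N -> (\int[Q]_g (EFin \o \1_A') (tr g) =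
      \int[Q]_g ((EFin \o \1_A') g * (expR (logdens_grid h beta k g))%:E))%E.
    move=> nk; have [B' [mB' e]] := dproj_refine (ltnW nk) mB.
    have nB : nnm (EFin \o \1_B' : seqm R -> \bar R) by exact: nnm_indic.
    have := @quasi_invariance_dyadic k _ (leq_ltn_trans (leq0n n) nk) nB.
    have iE : EFin \o \1_A' = (EFin \o \1_B') \o dproj k :> (G0m R -> \bar R).
      by rewrite /A' e; apply/funext => g /=; rewrite !indicE.
    by rewrite iE.
  have [C' hC'] := logdens_grid_bounded C2h b0.
  have eC k (g : G0m R) : expR (logdens_grid h beta k g) <= expR C'.
    by rewrite ler_expR; have := hC' k g; rewrite ler_norml => /andP[].
  have [mA1 A1] := nnm_indic (R := R) mA.
  pose F_ k g := ((\1_A' g * expR (logdens_grid h beta k g))%:E : \bar R).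
  pose F_lim (g : G0m R) := ((\1_A' g * Yb0 beta h (sval g))%:E : \bar R).
  have mF_ k : measurable_fun setT (F_ k).
    apply/measurable_EFinP; apply: measurable_funM; first exact: measurable_indic.
    exact: measurable_logdens_grid.
  have mF : measurable_fun setT F_lim.
    apply/measurable_EFinP; apply: measurable_funM; first exact: measurable_indic.
    exact: mY.
  have cF : {ae Q, forall g, setT g -> F_ ^~ g @ \oo --> F_lim g}.
    apply: aeW => g _; apply/cvg_EFin; first exact: nearW.
    by apply: cvgM; [exact: cvg_cst|exact: density_cvg].
  have bF : {ae Q, forall g, forall k, setT g -> (`|F_ k g| <= (EFin \o cst (expR C')) g)%E}.
    apply: aeW => g k _; rewrite /F_ /= lee_fin normrM.
    rewrite (ger0_norm (expR_ge0 _)) indicE.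
    by case: (_ \in _); rewrite ?normr1 ?normr0 ?mul1r ?mul0r ?expR_ge0.
  have [_ _ cv] := dominated_convergence measurableT mF_ mF cF
    (finite_measure_integrable_cst Q (expR C') measurableT) bF.
  apply/esym; apply: (@cvg_unique _ _ _ _ _ _ cv).
    exact: ereal_hausdorff.
  apply: cvg_near_cst; near=> k; apply/esym/const_seq.
  by near: k; exact: nbhs_infty_gt.
(* The whole space, as a cylinder, shows that both functionals have the same mass, a premise of the
   uniqueness principle. *)
have dT : dyadic_sets [set: G0m R] by exists 0%N, setT; split.
have c1 : cst 1%E = EFin \o \1_[set: G0m R] :> (G0m R -> \bar R) by rewrite indicT.
apply: (@integral_like_uniq R _ (G0m R) dyadic_sets _ _ (@measurable_dyadic R)
  (@setI_closed_dyadic R) HI HJ) => //.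
  rewrite (_ : _ \o _ = cst 1%E)// integral_cst// mul1e; exact: fin_num_measure.
by have := key _ dT; rewrite -c1.
Unshelve. all: by end_near. Qed.

Lemma quasi_invariance_set (A : set (G0m R)) : measurable A ->
  measurable (tau_img h A) /\
  Q (tau_img h A) = (\int[Q]_(g in A) (Yb0 beta h (sval g))%:E)%E.
Proof.
move=> mA; rewrite (tau_imgE dif chinv mono).
have mtA : measurable (tr @^-1` A).
  by rewrite -[X in measurable X]setTI; exact: measurable_translate.
split => //; rewrite -[X in Q X]setIT -(integral_indic Q measurableT mtA).
transitivity (\int[Q]_g (EFin \o \1_A) (tr g))%E.
  by apply: eq_integral => g _ /=; rewrite !indicE.
rewrite (quasi_invariance_integral (nnm_indic mA)) [RHS]integral_mkcond.
apply: eq_integral => g _; rewrite patchE /= indicE.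
by case: (g \in A); rewrite ?mul1e ?mul0e.
Qed.

End quasi_invariance.

Theorem theorem4p3 (R : realType) (beta : R) (h : R -> R)
    (Q : probability (G0m R) R) :
  0 < beta -> C2_isomorphism h -> dirichlet_marginals beta Q ->
  [/\ measurable_fun [set: G0m R] (fun g : G0m R => Yb0 beta h (sval g)),
      (forall A : set (G0m R), measurable A ->
         measurable (tau_img h A) /\
         Q (tau_img h A) = (\int[Q]_(g in A) (Yb0 beta h (sval g))%:E)%E) &
      exists c C : R, 0 < c /\
        forall g : G0m R, c <= Yb0 beta h (sval g) <= C].
Proof.
move=> b0 C2h dQ; have [hinv [dif chinv mono]] := C2_isomorphism_diffeo01 C2h.
split; [exact: measurable_Yb0| |exact: Yb0_bounds].
by move=> A mA; exact: (quasi_invariance_set b0 C2h dQ dif chinv mono mA).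
Qed.
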